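(* Suppose assumptions A1–A4 of the one-factor model hold. Let $\{\mathcal{P}(p):p=1,2,3,\dots\}$ be a semi-uniform sequence of $\beta$-ordered partitions (with $\mathcal{P}(p)$ a partition of $\{1,\dots,p\}$) such that the sequence $\{|\mathcal{P}(p)|\}$ tends to infinity and is square root dominated. Then $$\lim_{p\to\infty}\|\hat h_{L(\mathcal{P}(p))}-b\|=0\quad\text{almost surely.}$$
   Context: Model. Fix the number $n\ge 2$ of observations. Let $\beta=(\beta(1),\beta(2),\dots)$ be a random real sequence (fixed at the start of the observation window and constant during it), $X\in\mathbb{R}^n$ a random vector, and $Z=(Z_{ij})_{i\ge1,1\le j\le n}$ a random array. For each $p$ let $\beta^p\in\mathbb{R}^p$ and $Z^p\in\mathbb{R}^{p\times n}$ be the truncations to the first $p$ entries/rows, and $R^p=\beta^pX^T+Z^p\in\mathbb{R}^{p\times n}$. Superscripts $p$ are dropped when clear. Put $\mu_p(\beta)=\frac1p\sum_{i=1}^p\beta(i)$ and $d_p(\beta)^2=\frac1p\sum_{i=1}^p\big(\frac{\beta(i)-\mu_p(\beta)}{\mu_p(\beta)}\big)^2$. A1: the $\beta(i)$ are uniformly bounded independent random variables, and $\mu_p(\beta)$, $d_p(\beta)$ converge to limits $\mu_\infty(\beta)\in(0,\infty)$, $d_\infty(\beta)\in(0,\infty)$. A2: $\beta$, $X$, $Z$ are jointly independent. A3: the entries of $X$ are iid with mean zero and variance $\sigma^2>0$. A4: the entries $Z_{ij}$ have mean zero, finite variance $\delta^2>0$ and uniformly bounded fourth moments; the $n$-dimensional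 rows of $Z$ are mutually independent, and within each row the entries are pairwise uncorrelated. Notation. $\|\cdot\|$ and $(\cdot,\cdot)$ are the Euclidean norm and inner product. $b=\beta^p/\|\beta^p\|$; $q=(1,\dots,1)/\sqrt p\in\mathbb{R}^p$. $h=h^p$ is a unit eigenvector of $\frac1nR^p(R^p)^T$ for its largest eigenvalue $s_p^2$, with sign chosen so that $(h,q)\ge0$. $l_p^2$ is the average of the $n-1$ remaining nonzero eigenvalues, i.e. $l_p^2=\big(\mathrm{tr}(\frac1nR^p(R^p)^T)-s_p^2\big)/(n-1)$. $\psi_p=\sqrt{(s_p^2-l_p^2)/s_p^2}$. MAPS estimator. For a nontrivial proper linear subspace $L=L_p\subset\mathbb{R}^p$ with orthogonal projection $\mathrm{proj}_L$, $$\hat h_L=\frac{\tau_ph+\mathrm{proj}_L(h)}{\|\tau_ph+\mathrm{proj}_L(h)\|},\qquad \tau_p=\frac{\psi_p^2-\|\mathrm{proj}_L(h)\|^2}{1-\psi_p^2};$$ if $L$ is orthogonal to $h$, $\hat h_L=h$. Partitions. A partition $\mathcal{P}=\mathcal{P}(p)$ of $\{1,\dots,p\}$ is a collection of pairwise disjoint non-empty subsets (atoms) with union $\{1,\dots,p\}$; $|\mathcal{P}|$ is the number of atoms. The sequence $\mathcal{P}(p)$ is semi-uniform if there is $M>0$ with $\max_{I\in\mathcal{P}(p)}|I|\le M\,p/|\mathcal{P}(p)|$ for all $p$. $\mathcal{P}(p)$ is $\beta$-ordered if for all distinct $I,J\in\mathcal{P}(p)$ either $\max_{i\in I}\beta(i)\le\min_{j\in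 J}\beta(j)$ or $\max_{j\in J}\beta(j)\le\min_{i\in I}\beta(i)$. For $A\subset\{1,\dots,p\}$ nonempty let $v^A\in\mathbb{R}^p$ be the unit vector $v^A(i)=1_A(i)/\sqrt{|A|}$, and $L(\mathcal{P})=\mathrm{span}\{v^A: A\in\mathcal{P}\}$. A non-decreasing sequence $\{k_p\}$ of positive integers is square root dominated if $\sum_pk_p^2/p^2<\infty$.
   Formalization: The limit is proved almost surely on the event X ≠ 0, since A3 allows P(X=0)>0 and the claim can fail there; the partitions may be random but must be measurable functions of β (deterministic ones included), since partitions depending on Z can break the claim. *)

(* Defs.v *)
From HB Require Import structures.
From mathcomp Require Import all_boot all_order all_algebra.
From mathcomp Require Import all_classical all_reals all_analysis.
Set Implicit Arguments.
Unset Strict Implicit.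
Unset Printing Implicit Defensive.
Import Order.TTheory GRing.Theory Num.Theory.
Import numFieldNormedType.Exports.
Local Open Scope classical_set_scope.
Local Open Scope ring_scope.

(* Indices start at 0: the sequence beta(1), beta(2), ... is [beta 0],
    [beta 1], ..., the rows of Z are [Z 0], [Z 1], ..., and partitions of
    {1, ..., p} are partitions of ['I_p]. *)

(* The library's norm on matrices is the sup norm, hence [enorm]. *)
Definition dotv (R : realType) (p : nat) (u v : 'cV[R]_p) : R :=
  \sum_(i < p) u i 0 * v i 0.

Definition enorm (R : realType) (p : nat) (u : 'cV[R]_p) : R :=
  Num.sqrt (dotv u u).

Definition normalize (R : realType) (p : nat) (u : 'cV[R]_p) : 'cV[R]_p :=
  (enorm u)^-1 *: u.

Definition is_oproj (R : realType) (p : nat) (L : {vspace 'cV[R]_p})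
    (v w : 'cV[R]_p) : Prop :=
  w \in L /\ forall u, u \in L -> dotv u (v - w) = 0.

(* [is_oproj L v] has exactly one solution, see [oprojP] and [oproj_uniq]. *)
Definition oproj (R : realType) (p : nat) (L : {vspace 'cV[R]_p})
    (v : 'cV[R]_p) : 'cV[R]_p :=
  get [set w | is_oproj L v w].

Lemma dotvC (R : realType) (p : nat) (u v : 'cV[R]_p) : dotv u v = dotv v u.
Proof. by apply: eq_bigr => i _; rewrite mulrC. Qed.

Lemma dotvDr (R : realType) (p : nat) (u v w : 'cV[R]_p) :
  dotv u (v + w) = dotv u v + dotv u w.
Proof. by rewrite -big_split; apply: eq_bigr => i _; rewrite !mxE mulrDr. Qed.

Lemma dotvZr (R : realType) (p : nat) (a : R) (u v : 'cV[R]_p) :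
  dotv u (a *: v) = a * dotv u v.
Proof.
by rewrite /dotv big_distrr; apply: eq_bigr => i _; rewrite !mxE mulrCA.
Qed.

Lemma dotvBr (R : realType) (p : nat) (u v w : 'cV[R]_p) :
  dotv u (v - w) = dotv u v - dotv u w.
Proof. by rewrite dotvDr -scaleN1r dotvZr mulN1r. Qed.

Lemma dotv0l (R : realType) (p : nat) (u : 'cV[R]_p) : dotv 0 u = 0.
Proof. by rewrite dotvC -(scale0r u) dotvZr mul0r. Qed.

Lemma dotv_eq0 (R : realType) (p : nat) (u : 'cV[R]_p) :
  dotv u u = 0 -> u = 0.
Proof.
move=> /eqP; rewrite psumr_eq0 => [/allP u0|i _]; last by rewrite -expr2 sqr_ge0.
apply/colP => i; have := u0 i (mem_index_enum i).
by rewrite mulf_eq0 orbb mxE => /eqP.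
Qed.

Lemma is_oproj_uniq (R : realType) (p : nat) (L : {vspace 'cV[R]_p})
    (v w w' : 'cV[R]_p) :
  is_oproj L v w -> is_oproj L v w' -> w = w'.
Proof.
move=> [wL wO] [wL' wO']; apply/eqP; rewrite -subr_eq0; apply/eqP/dotv_eq0.
have DL : w - w' \in L by rewrite rpredB.
have {2}-> : w - w' = (v - w') - (v - w).
  by rewrite opprB [RHS]addrC addrA subrK.
by rewrite dotvBr wO // wO' // subrr.
Qed.

Lemma is_oproj_ex (R : realType) (p : nat) (L : {vspace 'cV[R]_p})
    (v : 'cV[R]_p) : exists w, is_oproj L v w.
Proof.
suff H (s : seq 'cV[R]_p) x : exists w, is_oproj << s >>%VS x w.
  by have := H (vbasis L) v; rewrite (span_basis (vbasisP L)).
elim: s x => [x|a s IHs x].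
  exists 0; split; first by rewrite mem0v.
  move=> u; rewrite span_nil memv0 => /eqP ->.
  by rewrite dotv0l.
have [a1 [a1s a1O]] := IHs a; have [x1 [x1s x1O]] := IHs x.
pose c := a - a1; pose t := dotv c x / dotv c c.
exists (x1 + t *: c).
have sS y : y \in << s >>%VS -> y \in <<a :: s>>%VS.
  by move: y; apply/subvP; rewrite span_cons addvSr.
have aS : a \in <<a :: s>>%VS by rewrite memv_span ?mem_head.
split; first by apply: memvD; [exact: sS|apply/memvZ/memvB => //; exact: sS].
have cO u : u \in << s >>%VS -> dotv u (x - (x1 + t *: c)) = 0.
  move=> us; rewrite opprD addrA dotvBr dotvZr x1O //.
  by rewrite /c a1O // mulr0 subrr.
move=> u; rewrite span_cons => /memv_addP[_ /vlineP[k ->] [y ys ->]].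
have -> : k *: a + y = k *: c + (k *: a1 + y).
  by rewrite addrA -scalerDr subrK.
rewrite dotvC dotvDr dotvZr [X in _ + X]dotvC cO ?addr0; last first.
  by apply: memvD => //; exact: memvZ.
rewrite dotvC dotvBr dotvDr dotvZr.
have -> : dotv c x1 = 0 by rewrite dotvC /c a1O.
rewrite add0r /t; have [/dotv_eq0 c0|cN0] := eqVneq (dotv c c) 0.
  by rewrite c0 !dotv0l mulr0 subrr mulr0.
by rewrite divfK // subrr mulr0.
Qed.

Lemma oprojP (R : realType) (p : nat) (L : {vspace 'cV[R]_p})
    (v : 'cV[R]_p) : is_oproj L v (oproj L v).
Proof. by have [w Hw] := is_oproj_ex L v; exact: (getI (x := w)). Qed.

Lemma oproj_uniq (R : realType) (p : nat) (L : {vspace 'cV[R]_p})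
    (v w : 'cV[R]_p) : is_oproj L v w -> oproj L v = w.
Proof. by move=> vw; exact: is_oproj_uniq (oprojP L v) vw. Qed.

(* For the symmetric matrices it is applied to, the set is finite and
   nonempty as soon as 0 < p, so that the supremum is a maximum. *)
Definition lambda_max (R : realType) (p : nat) (A : 'M[R]_p) : R :=
  sup [set a | eigenvalue A a].

Definition sample_cov (R : realType) (p n : nat) (Y : 'M[R]_(p, n)) :
    'M[R]_p :=
  n%:R^-1 *: (Y *m Y^T).

Definition s2 (R : realType) (p n : nat) (Y : 'M[R]_(p, n)) : R :=
  lambda_max (sample_cov Y).

Definition l2 (R : realType) (p n : nat) (Y : 'M[R]_(p, n)) : R :=
  (\tr (sample_cov Y) - s2 Y) / (n.-1)%:R.

Definition psi (R : realType) (p n : nat) (Y : 'M[R]_(p, n)) : R :=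
  Num.sqrt ((s2 Y - l2 Y) / s2 Y).

Definition qvec (R : realType) (p : nat) : 'cV[R]_p :=
  const_mx (Num.sqrt p%:R)^-1.

Definition leading_eigvec (R : realType) (p n : nat) (Y : 'M[R]_(p, n))
    (h : 'cV[R]_p) : Prop :=
  [/\ sample_cov Y *m h = s2 Y *: h, enorm h = 1 & 0 <= dotv h (qvec R p)].

Definition tau (R : realType) (p n : nat) (Y : 'M[R]_(p, n))
    (h : 'cV[R]_p) (L : {vspace 'cV[R]_p}) : R :=
  (psi Y ^+ 2 - enorm (oproj L h) ^+ 2) / (1 - psi Y ^+ 2).

Definition maps (R : realType) (p n : nat) (Y : 'M[R]_(p, n))
    (h : 'cV[R]_p) (L : {vspace 'cV[R]_p}) : 'cV[R]_p :=
  if `[< forall u, u \in L -> dotv u h = 0 >] then h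
  else normalize (tau Y h L *: h + oproj L h).

Definition atom_vec (R : realType) (p : nat) (A : {set 'I_p}) : 'cV[R]_p :=
  \col_i ((i \in A)%:R / Num.sqrt #|A|%:R).

Definition partition_space (R : realType) (p : nat)
    (Q : {set {set 'I_p}}) : {vspace 'cV[R]_p} :=
  <<[seq atom_vec R A | A <- enum Q]>>%VS.

Definition semi_uniform (R : realType)
    (Q : forall p : nat, {set {set 'I_p}}) : Prop :=
  exists2 M : R, 0 < M & forall p : nat, (0 < p)%N ->
    (\max_(I in Q p) #|I|)%:R <= M * p%:R / #|Q p|%:R.

(* max_I x <= min_J x, spelled out on the nonempty finite sets I and J. *)
Definition ordered_partition (R : realType) (x : nat -> R) (p : nat)
    (Q : {set {set 'I_p}}) : Prop :=
  forall I J : {set 'I_p}, I \in Q -> J \in Q -> I != J ->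
    (forall i j : 'I_p, i \in I -> j \in J -> x i <= x j) \/
    (forall i j : 'I_p, i \in I -> j \in J -> x j <= x i).

Definition sqrt_dominated (R : realType) (k : nat -> nat) : Prop :=
  [/\ forall p : nat, (0 < p)%N -> (0 < k p)%N,
      forall p q : nat, (0 < p)%N -> (p <= q)%N -> (k p <= k q)%N &
      cvgn (series (fun p : nat => (k p)%:R ^+ 2 / p%:R ^+ 2 : R))].

Definition sigma_rv (d : measure_display) (T : measurableType d)
    (R : realType) (I : Type) (X : I -> T -> R) : set (set T) :=
  <<s \bigcup_i preimage_set_system setT (X i) measurable >>.

(* In every use below each [F i] is a sigma-algebra, so this is the usual
   independence of sigma-algebras; for random variables or rows of Z the
   [F i] are the sigma-algebras they generate. *)
Definition mutual_indep (d : measure_display) (T : measurableType d)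
    (R : realType) (P : probability T R) (I : eqType)
    (F : I -> set (set T)) : Prop :=
  forall (s : seq I) (E : I -> set T), uniq s ->
    (forall i, i \in s -> F i (E i)) ->
    P (\bigcap_(i in [set` s]) E i) = (\prod_(i <- s) P (E i))%E.

Definition beta_vec (R : realType) (x : nat -> R) (p : nat) : 'cV[R]_p :=
  \col_(i < p) x i.

Definition returns (R : realType) (n : nat) (x : nat -> R) (f : 'I_n -> R)
    (z : nat -> 'I_n -> R) (p : nat) : 'M[R]_(p, n) :=
  beta_vec x p *m (\col_(j < n) f j)^T + \matrix_(i < p, j < n) z i j.

Definition beta_mean (R : realType) (x : nat -> R) (p : nat) : R :=
  p%:R^-1 * \sum_(i < p) x i.

Definition beta_disp (R : realType) (x : nat -> R) (p : nat) : R :=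
  Num.sqrt (p%:R^-1 *
    \sum_(i < p) ((x i - beta_mean x p) / beta_mean x p) ^+ 2).

(* The limits of [beta_mean] and [beta_disp] may depend on the outcome. *)
Definition A1 (d : measure_display) (T : measurableType d) (R : realType)
    (P : probability T R) (beta : nat -> {RV P >-> R}) : Prop :=
  [/\ exists C : R, forall i, {ae P, forall w, `|beta i w| <= C},
      mutual_indep P (fun i => sigma_rv (fun _ : unit => beta i)) &
      {ae P, forall w,
        (exists2 m : R, 0 < m & beta_mean (beta ^~ w) @ \oo --> m) /\
        (exists2 r : R, 0 < r & beta_disp (beta ^~ w) @ \oo --> r)}].

Definition A2 (d : measure_display) (T : measurableType d) (R : realType)
    (P : probability T R) (n : nat) (beta : nat -> {RV P >-> R})
    (X : 'I_n -> {RV P >-> R}) (Z : nat -> 'I_n -> {RV P >-> R}) : Prop :=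
  mutual_indep P (fun k : 'I_3 => tnth
    [tuple sigma_rv beta; sigma_rv X;
           sigma_rv (fun ij : nat * 'I_n => Z ij.1 ij.2)] k).

(* A non-integrable random variable never has expectation 0: its expectation
   is infinite, with the convention +oo - +oo = -oo. Mean zero thus entails
   integrability, and a finite variance then gives square integrability. The
   same remark applies to [A4]. *)
Definition A3 (d : measure_display) (T : measurableType d) (R : realType)
    (P : probability T R) (n : nat) (X : 'I_n -> {RV P >-> R})
    (sigma : R) : Prop :=
  [/\ 0 < sigma,
      mutual_indep P (fun j => sigma_rv (fun _ : unit => X j)),
      forall j k, distribution P (X j) =1 distribution P (X k),
      forall j, ('E_P[X j] = 0)%E &
      forall j, 'V_P[X j] = (sigma ^+ 2)%:E].

Definition A4 (d : measure_display) (T : measurableType d) (R : realType)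
    (P : probability T R) (n : nat) (Z : nat -> 'I_n -> {RV P >-> R})
    (delta : R) : Prop :=
  [/\ 0 < delta,
      forall i j, ('E_P[Z i j] = 0)%E /\ 'V_P[Z i j] = (delta ^+ 2)%:E,
      exists C : R, forall i j, ('E_P[fun w => (Z i j w ^+ 4)%R] <= C%:E)%E,
      mutual_indep P (fun i => sigma_rv (Z i)) &
      forall i j k, j != k -> (covariance P (Z i j) (Z i k) = 0)%E].

(* Main.v *)
Require Import Defs.
From HB Require Import structures.
From mathcomp Require Import all_boot all_order all_algebra.
From mathcomp Require Import all_classical all_reals all_analysis.
From mathcomp Require Import measurable_realfun ring lra zify.
Import Order.TTheory GRing.Theory Num.Theory.
Import numFieldNormedType.Exports.
Set Implicit Arguments.
Unset Strict Implicit.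
Unset Printing Implicit Defensive.
Local Open Scope classical_set_scope.
Local Open Scope ring_scope.

(* Fix an outcome and write Y for the returns, A = Y^T Y / p, x for beta and f
   for the factor. Strong laws give A --> B f f^T + delta^2 I entrywise, where
   B = lim |x|^2 / p. The scores g = Y^T h / sqrt p satisfy A g = lambda g and
   |g|^2 = lambda with lambda = n s^2 / p the top eigenvalue of A; Rayleigh
   quotients force lambda --> B |f|^2 + delta^2 and (f, g)^2 --> |f|^2 lim
   lambda, and (h, q) >= 0 selects the sign of (f, g). Since
   lambda h = Y g / sqrt p, every inner product of h with x, with q or with the
   projection of h on L is a combination of x and of the columns of Z with
   coefficients bounded by sqrt lambda. The projections of the columns of Z
   on L are o(sqrt p), and those of x are x + o(sqrt p), because the ranges of
   beta on the atoms do not overlap. Hence |proj_L h|^2 and psi^2 have the same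
   limit, tau --> 0, and the estimator is asymptotically the direction of
   proj_L h, i.e. b.

   For a fixed partition with k atoms the fourth moment of the projection of
   a column of Z is O(k^2), so dividing by p^2 gives a summable series. The
   partition being random but a function of beta, hence independent of Z, the
   series is summed over the possible partitions, on the events where the
   partial sums of k_q^2 / q^2 stay below a given bound. *)

(** * Euclidean inner product and Rayleigh quotients *)

Lemma cvg_sumr (R : realType) (I T : Type) (F : set_system T) {FF : Filter F}
    (r : seq I) (D : pred I) (f : I -> T -> R) (a : I -> R) :
  (forall i, D i -> f i x @[x --> F] --> a i) ->
  \sum_(i <- r | D i) f i x @[x --> F] --> \sum_(i <- r | D i) a i.
Proof.
move=> fa; elim: r => [|i r IHr].
  by rewrite big_nil; under eq_fun do rewrite big_nil; exact: cvg_cst.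
rewrite big_cons; under eq_fun do rewrite big_cons.
by case: ifPn => // Di; apply: cvgD => //; exact: fa.
Qed.

Section inner_product.
Context {R : realType}.

Lemma dotvv_ge0 (p : nat) (u : 'cV[R]_p) : 0 <= dotv u u.
Proof. by apply: sumr_ge0 => i _; rewrite -expr2 sqr_ge0. Qed.

Lemma dotvDl (p : nat) (u v w : 'cV[R]_p) : dotv (u + v) w = dotv u w + dotv v w.
Proof. by rewrite dotvC dotvDr !(dotvC w). Qed.

Lemma dotvZl (p : nat) (a : R) (u v : 'cV[R]_p) : dotv (a *: u) v = a * dotv u v.
Proof. by rewrite dotvC dotvZr dotvC. Qed.

Lemma dotv_sumr (p : nat) (I : Type) (s : seq I) (D : pred I)
    (F : I -> 'cV[R]_p) (u : 'cV[R]_p) :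
  dotv u (\sum_(i <- s | D i) F i) = \sum_(i <- s | D i) dotv u (F i).
Proof.
elim/big_rec2: _ => [|i y1 y2 _ <-]; first by rewrite dotvC dotv0l.
by rewrite dotvDr.
Qed.

Lemma dotv_suml (p : nat) (I : Type) (s : seq I) (D : pred I)
    (F : I -> 'cV[R]_p) (u : 'cV[R]_p) :
  dotv (\sum_(i <- s | D i) F i) u = \sum_(i <- s | D i) dotv (F i) u.
Proof. by rewrite dotvC dotv_sumr; apply: eq_bigr => i _; rewrite dotvC. Qed.

Lemma dotv_mulmx (p q : nat) (A : 'M[R]_(p, q)) (u : 'cV[R]_p) (v : 'cV[R]_q) :
  dotv u (A *m v) = dotv (A^T *m u) v.
Proof.
rewrite /dotv; under eq_bigr do rewrite mxE mulr_sumr.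
rewrite exchange_big; apply: eq_bigr => j _ /=.
rewrite mxE mulr_suml; apply: eq_bigr => i _; rewrite mxE; ring.
Qed.

Lemma enorm_sqr (p : nat) (u : 'cV[R]_p) : enorm u ^+ 2 = dotv u u.
Proof. by rewrite sqr_sqrtr ?dotvv_ge0. Qed.

(** For c > 0 the value at the minimiser t = - b / c gives the bound; for c <= 0 some t makes the
    quadratic negative unless b = c = 0. The sign of c is left free so that Cauchy-Schwarz with a
    zero vector is covered. *)
Lemma quadratic_discr_le (a b c : R) :
  (forall t, 0 <= a + 2 * b * t + c * t ^+ 2) -> b ^+ 2 <= a * c.
Proof.
move=> H; have a0 : 0 <= a by have := H 0; rewrite mulr0 expr0n mulr0 !addr0.
have [c0|c0] := ltP 0 c.
  have := H (- b / c).
  have -> : a + 2 * b * (- b / c) + c * (- b / c) ^+ 2 = a - b ^+ 2 / c.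
    by field; rewrite gt_eqF.
  by rewrite subr_ge0 ler_pdivrMr.
have [b0|bN0] := eqVneq b 0.
  have [->|cN0] := eqVneq c 0; first by rewrite b0 mulr0 expr0n.
  have cn : c < 0 by rewrite lt_neqAle cN0.
  have := H (Num.sqrt ((a + 1) / - c)).
  rewrite b0 mulr0 mul0r addr0 sqr_sqrtr; last first.
    by rewrite divr_ge0 ?addr_ge0// oppr_ge0 ltW.
  rewrite (_ : c * _ = - (a + 1)); first lra.
  by field.
have := H (- (a + 1) / (2 * b)).
have -> : 2 * b * (- (a + 1) / (2 * b)) = - (a + 1) by field.
have := mulr_le0_ge0 c0 (sqr_ge0 (- (a + 1) / (2 * b))); lra.
Qed.

Lemma dotv_CS (p : nat) (u v : 'cV[R]_p) :
  dotv u v ^+ 2 <= dotv u u * dotv v v.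
Proof.
apply: quadratic_discr_le => t.
rewrite (_ : _ + _ = dotv (u + t *: v) (u + t *: v)) ?dotvv_ge0//.
rewrite !(dotvDl, dotvDr, dotvZl, dotvZr) (dotvC v u); ring.
Qed.

Lemma sum_CS (n : nat) (u v : 'I_n -> R) :
  (\sum_j u j * v j) ^+ 2 <= (\sum_j u j ^+ 2) * (\sum_j v j ^+ 2).
Proof.
have := dotv_CS (\col_j u j) (\col_j v j); congr (_ ^+ 2 <= _ * _);
  by apply: eq_bigr => j _; rewrite !mxE.
Qed.

End inner_product.

Section rayleigh.
Context {R : realType} {p : nat} (A : 'M[R]_p).
Hypothesis symA : A^T = A.

(** The quadratic form is continuous, hence attains its maximum on the compact unit sphere, nonempty
    because 0 < p; homogeneity of degree two extends the bound to all vectors. *)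
Lemma rayleigh_max : (0 < p)%N -> exists v : 'cV[R]_p, dotv v v = 1 /\
  forall u, dotv u (A *m u) <= dotv v (A *m v) * dotv u u.
Proof.
(* The sphere lives in row vectors, the setting of the compactness and extreme value theorems
   applied below. *)
move=> p0; pose S := [set u : 'rV[R]_p | dotv u^T u^T = 1].
have cf i : continuous (fun u : 'rV[R]_p => u 0 i) by exact: coord_continuous.
have cdot : continuous (fun u : 'rV[R]_p => dotv u^T u^T).
  move=> u; rewrite /dotv.
  apply: (@cvg_sumr _ _ _ (nbhs u)) => i _.
  by apply: cvgM; under eq_fun do rewrite mxE; rewrite mxE; exact: cf.
have cquad : continuous (fun u : 'rV[R]_p => dotv u^T (A *m u^T)).
  move=> u; rewrite /dotv.
  apply: (@cvg_sumr _ _ _ (nbhs u)) => i _; apply: cvgM.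
    by under eq_fun do rewrite mxE; rewrite mxE; exact: cf.
  under eq_fun do rewrite mxE; rewrite mxE.
  apply: (@cvg_sumr _ _ _ (nbhs u)) => j _; apply: cvgM; first exact: cvg_cst.
  by under eq_fun do rewrite mxE; rewrite mxE; exact: cf.
have cS : compact S.
  apply: bounded_closed_compact.
    exists 1; split => // M M1 u /= Su.
    rewrite /Num.Def.normr/= mx_normrE; apply/bigmax_leP; split => [|[i j] _ /=].
      by rewrite ltW// (lt_trans _ M1).
    rewrite ord1 (le_trans _ (ltW M1))// -(@expr_le1 _ 2)// real_normK ?num_real//.
    rewrite -Su /dotv (bigD1 j)//= !mxE -expr2 lerDl.
    by apply: sumr_ge0 => k _; rewrite -expr2 sqr_ge0.
  have -> : S = (fun u : 'rV[R]_p => dotv u^T u^T) @^-1` [set 1] by [].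
  by apply: closed_comp => [u _|]; [exact: cdot|exact: closed_eq].
have S0 : S !=set0.
  exists (delta_mx 0 (Ordinal p0)); rewrite /S/= /dotv (bigD1 (Ordinal p0))//=.
  rewrite !mxE !eqxx mulr1 big1 ?addr0// => i /negPf iN.
  by rewrite !mxE eqxx iN mulr0.
have [v Sv vmax] := EVT_max_rV S0 cS (continuous_subspaceT cquad).
exists v^T; split; first by move: Sv; rewrite inE.
move=> u; have [->|uN0] := eqVneq u 0.
  by rewrite mulmx0 dotv0l mulr0.
have u0 : 0 < dotv u u.
  by rewrite lt_neqAle dotvv_ge0 andbT eq_sym; apply: contra uN0 => /eqP/dotv_eq0 ->.
have e0 : enorm u != 0 by rewrite sqrtr_eq0 -ltNge.
have := vmax ((enorm u)^-1 *: u)^T.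
rewrite trmxK -scalemxAr dotvZl dotvZr => H.
have : (enorm u)^-1 * ((enorm u)^-1 * dotv u (A *m u)) <= dotv v^T (A *m v^T).
  apply: H; rewrite inE /S/= trmxK dotvZl dotvZr -enorm_sqr.
  by rewrite expr2 mulrA mulrACA mulVf// mul1r.
by rewrite mulrA -expr2 exprVn enorm_sqr ler_pdivrMl// mulrC.
Qed.

(** A maximiser of the Rayleigh quotient is an eigenvector, so its value [rho] lies in the set whose
    supremum is [lambda_max A]. The same maximality shows that [rho] bounds this set. Symmetry
    translates between the row eigenvectors of [eigenvalue] and column vectors. *)
Lemma rayleigh_le_lambda_max (u : 'cV[R]_p) :
  dotv u (A *m u) <= lambda_max A * dotv u u.
Proof.
have [p0|] := posnP p.
  suff -> : u = 0 by rewrite mulmx0 dotv0l mulr0.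
  by apply/colP => -[i ip]; exfalso; move: ip; rewrite p0.
move=> /rayleigh_max[v [v1 vmax]]; set rho := dotv v (A *m v) in vmax.
have vE : A *m v = rho *: v.
  apply/eqP; rewrite eq_sym -subr_eq0; apply/eqP; set w := _ - _.
  have vw : dotv v w = 0 by rewrite /w dotvBr dotvZr v1 mulr1 subrr.
  have ww : dotv w w = - dotv w (A *m v).
    by rewrite {2}/w dotvBr dotvZr (dotvC w v) vw mulr0 sub0r.
  clearbody w.
  (* the nonnegative form [rho |x|^2 - (x, A x)] vanishes at [v], hence so
     does its gradient *)
  apply: dotv_eq0; apply/eqP; rewrite -sqrf_eq0; apply/eqP/le_anti.
  rewrite sqr_ge0 andbT -(mul0r (rho * dotv w w - dotv w (A *m w))).
  apply: quadratic_discr_le => t; rewrite add0r.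
  have := vmax (v + t *: w).
  rewrite mulmxDr -scalemxAr !(dotvDl, dotvDr, dotvZl, dotvZr) v1 (dotvC w v) vw.
  have -> : dotv v (A *m w) = dotv w (A *m v) by rewrite dotv_mulmx symA dotvC.
  rewrite -/rho ww -subr_ge0 => H; apply: le_trans H _.
  rewrite le_eqVlt; apply/orP; left; apply/eqP; ring.
apply: le_trans (vmax u) _; rewrite ler_wpM2r ?dotvv_ge0//.
apply: ub_le_sup.
  exists rho => a /= /eigenvalueP[x xE x0].
  have {}xE : A *m x^T = a *: x^T by rewrite -[in LHS]symA -trmx_mul xE linearZ.
  have := vmax x^T; rewrite xE dotvZr ler_pM2r// lt_neqAle dotvv_ge0 andbT eq_sym.
  by apply: contra x0 => /eqP/dotv_eq0 /(congr1 trmx); rewrite trmxK trmx0 => ->.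
apply/eigenvalueP; exists v^T.
  by rewrite -[in LHS]symA -trmx_mul vE linearZ.
apply: contra_eq_neq v1 => /(congr1 trmx); rewrite trmxK trmx0 => ->.
by rewrite dotv0l eq_sym oner_neq0.
Qed.

End rayleigh.

(** * Projection on a partition space *)

Section partition_projection.
Context {R : realType} {p : nat}.
Implicit Types (u v : 'cV[R]_p) (A B : {set 'I_p}).

(** The bilinear form (u, proj v) of the projection on [partition_space R Q], see
    [dotv_oproj_partition]. Explicit atom sums make it accessible to moment computations when the
    partition is fixed. *)
Definition blockdot (Q : {set {set 'I_p}}) (u v : 'cV[R]_p) : R :=
  \sum_(A in Q) (\sum_(i in A) u i 0) * (\sum_(i in A) v i 0) / #|A|%:R.

Lemma dotv_atom A u :
  dotv (atom_vec R A) u = (\sum_(i in A) u i 0) / Num.sqrt #|A|%:R.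
Proof.
rewrite /dotv mulr_suml [RHS]big_mkcond; apply: eq_bigr => i _.
by rewrite mxE; case: ifP => _; rewrite ?mul0r// mul1r mulrC.
Qed.

Lemma sum_atom A B :
  \sum_(i in A) atom_vec R B i 0 = #|A :&: B|%:R / Num.sqrt #|B|%:R.
Proof.
rewrite -sum1_card natr_sum mulr_suml [LHS]big_mkcond [RHS]big_mkcond /=.
apply: eq_bigr => i _; rewrite mxE inE.
by case: (i \in A); case: (i \in B); rewrite ?mul0r.
Qed.

Lemma dotv_atoms (Q : {set {set 'I_p}}) A B :
  finset.trivIset Q -> finset.set0 \notin Q ->
  A \in Q -> B \in Q -> dotv (atom_vec R A) (atom_vec R B) = (A == B)%:R.
Proof.
move=> tQ Q0 AQ BQ; rewrite dotv_atom sum_atom.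
have [<-|AB] := eqVneq A B.
  have A0 : (0 < #|A|)%N by rewrite card_gt0; apply: contraNneq Q0 => <-.
  rewrite finset.setIid -mulrA -invfM -expr2 sqr_sqrtr// divff//.
  by rewrite pnatr_eq0 -lt0n.
have /finset.disjoint_setI0 -> := finset.trivIsetP tQ A B AQ BQ AB.
by rewrite cards0 !mul0r.
Qed.

Lemma oproj_partition (Q : {set {set 'I_p}}) v :
  finset.trivIset Q -> finset.set0 \notin Q ->
  oproj (partition_space R Q) v =
    \sum_(A in Q) dotv (atom_vec R A) v *: atom_vec R A.
Proof.
move=> tQ Q0; apply: oproj_uniq; split.
  apply: rpred_sum => A AQ; apply/rpredZ/memv_span/mapP.
  by exists A => //; rewrite mem_enum.
pose X := in_tuple [seq atom_vec R A | A <- enum Q].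
move=> u; rewrite (_ : partition_space R Q = <<X>>%VS)// => /coord_span ->.
rewrite dotv_suml big1// => i _.
rewrite dotvZl; set a := (_`_ _).
have /mapP[A] : a \in [seq atom_vec R A | A <- enum Q] by exact: mem_nth.
rewrite mem_enum => AQ ->; rewrite dotvBr dotv_sumr (bigD1 A)//=.
rewrite dotvZr (dotv_atoms tQ)// eqxx mulr1 big1 ?addr0 ?subrr ?mulr0//.
move=> B /andP[BQ /negPf BA].
by rewrite dotvZr (dotv_atoms tQ)// eq_sym BA mulr0.
Qed.

Lemma dotv_oproj_partition (Q : {set {set 'I_p}}) u v :
  finset.trivIset Q -> finset.set0 \notin Q ->
  dotv u (oproj (partition_space R Q) v) = blockdot Q u v.
Proof.
move=> tQ Q0; rewrite oproj_partition// dotv_sumr; apply: eq_bigr => A AQ.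
rewrite dotvZr (dotvC u) !dotv_atom mulrACA -invfM -expr2 sqr_sqrtr//.
by rewrite [X in X / _]mulrC.
Qed.

Lemma dotv_oproj2 (L : {vspace 'cV[R]_p}) u v :
  dotv u (oproj L v) = dotv (oproj L u) (oproj L v).
Proof.
have [_ uO] := oprojP L u; have [vL _] := oprojP L v.
by apply/eqP; rewrite -subr_eq0 dotvC (dotvC _ (oproj L v)) -dotvBr uO.
Qed.

Lemma dotv_oprojC (L : {vspace 'cV[R]_p}) u v :
  dotv u (oproj L v) = dotv v (oproj L u).
Proof. by rewrite dotv_oproj2 dotvC -dotv_oproj2. Qed.

Lemma oproj_CS (L : {vspace 'cV[R]_p}) u v :
  dotv u (oproj L v) ^+ 2 <= dotv u (oproj L u) * dotv v (oproj L v).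
Proof.
rewrite (dotv_oproj2 L u v) (dotv_oproj2 L u u) (dotv_oproj2 L v v).
exact: dotv_CS.
Qed.

(** With e = (u, proj u) = |proj u|^2, Cauchy-Schwarz gives e^2 <= |u|^2 e, and e cancels unless it
    is 0. *)
Lemma dotv_oproj_le (L : {vspace 'cV[R]_p}) u : dotv u (oproj L u) <= dotv u u.
Proof.
set e := dotv u (oproj L u).
have e0 : 0 <= e by rewrite /e dotv_oproj2 dotvv_ge0.
have [->|eN0] := eqVneq e 0; first exact: dotvv_ge0.
rewrite -(@ler_pM2r _ e) ?lt_neqAle 1?eq_sym ?eN0// -expr2.
by apply: le_trans (dotv_CS _ _) _; rewrite -dotv_oproj2.
Qed.

End partition_projection.

(** Strong induction on the number of intervals: the first interval leaves the others either in
    [b i, hi] or in [lo, a i], and the three bounds add up to hi - lo. The bounds lo and hi vary in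
    the induction. *)
Lemma nonoverlapping_sum_le (R : realType) (I : eqType) (s : seq I)
    (a b : I -> R) (lo hi : R) : uniq s -> lo <= hi ->
  (forall i, i \in s -> [/\ lo <= a i, a i <= b i & b i <= hi]) ->
  (forall i j, i \in s -> j \in s -> i != j -> b i <= a j \/ b j <= a i) ->
  \sum_(i <- s) (b i - a i) <= hi - lo.
Proof.
have [k] := ubnP (size s); elim: k s lo hi => // k IH s lo hi; case: s => [|i s].
  by rewrite big_nil subr_ge0.
rewrite /= ltnS => sk /andP[iNs us] lohi Hab Hij; rewrite big_cons.
have [loi ii ihi] := Hab i (mem_head _ _).
rewrite (bigID (fun j => b i <= a j))/= -big_filter -[X in _ + (_ + X)]big_filter.
have sub (D : pred I) j : j \in seq.filter D s -> [/\ j \in s, D j & j \in i :: s].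
  by rewrite mem_filter => /andP[-> js]; rewrite inE js orbT.
have size_f (D : pred I) : (size (seq.filter D s) < k)%N.
  by apply: leq_ltn_trans sk; rewrite size_filter count_size.
have ji j : j \in s -> j != i by apply: contraTneq => ->.
have H1 : \sum_(j <- [seq j <- s | b i <= a j]) (b j - a j) <= hi - b i.
  apply: IH => //; first exact: filter_uniq.
    by move=> j /sub[js bj /Hab[_ ? ?]].
  by move=> j l /sub[_ _ js] /sub[_ _ ls]; exact: Hij.
have H2 : \sum_(j <- [seq j <- s | ~~ (b i <= a j)]) (b j - a j) <= a i - lo.
  apply: IH => //; first exact: filter_uniq.
    move=> j /sub[js bj js']; have [? ? _] := Hab _ js'; split => //.
    have [//|bij] := Hij j i js' (mem_head _ _) (ji _ js).
    by rewrite bij in bj.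
  by move=> j l /sub[_ _ js] /sub[_ _ ls]; exact: Hij.
lra.
Qed.

Lemma finset_minmax (R : realType) (p : nat) (x : nat -> R) (A : {set 'I_p}) :
  A != finset.set0 -> exists ab : 'I_p * 'I_p, [/\ ab.1 \in A, ab.2 \in A &
    forall k : 'I_p, k \in A -> x ab.1 <= x k <= x ab.2].
Proof.
move=> /finset.set0Pn[i0 i0A].
have [i iA imin] := arg_minP (fun i : 'I_p => x i) i0A.
have [j jA jmax] := arg_maxP (fun i : 'I_p => x i) i0A.
exists (i, j); split => //= k kA; apply/andP; split; [exact: imin|exact: jmax].
Qed.

(** The left side is the sum of squared deviations from the mean over A, the least value of the
    right side as a varies. *)
Lemma sum_sqr_centered_le (R : realType) (I : finType) (A : {set I})
    (u : I -> R) (a : R) : A != finset.set0 ->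
  \sum_(i in A) u i ^+ 2 - (\sum_(i in A) u i) * (\sum_(i in A) u i) / #|A|%:R
  <= \sum_(i in A) (u i - a) ^+ 2.
Proof.
move=> A0; have c0 : #|A|%:R != 0 :> R by rewrite pnatr_eq0 cards_eq0.
have -> : \sum_(i in A) (u i - a) ^+ 2 =
    \sum_(i in A) u i ^+ 2 - 2 * a * \sum_(i in A) u i + #|A|%:R * a ^+ 2.
  have -> : #|A|%:R * a ^+ 2 = \sum_(i in A) a ^+ 2 by rewrite sumr_const mulr_natl.
  rewrite mulr_sumr -sumrB -big_split.
  by apply: eq_bigr => i _ /=; ring.
set S := \sum_(i in A) u i; set c : R := #|A|%:R in c0 *.
rewrite -subr_ge0 [X in 0 <= X](_ : _ = (S - c * a) ^+ 2 / c); last by field.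
by rewrite divr_ge0 ?sqr_ge0.
Qed.

(** The defect is the sum over the atoms of the squared deviations from the atom means. An atom
    contributes at most |A| 2C times its range, and the ranges are non-overlapping intervals inside
    [-C, C], so that they sum to at most 2C. *)
Lemma ordered_partition_defect_le (R : realType) (p : nat) (x : nat -> R)
    (C K : R) (Q : {set {set 'I_p}}) : (0 < p)%N -> 0 <= K ->
  (forall i, `|x i| <= C) -> finset.partition Q [set: 'I_p]%SET ->
  ordered_partition x Q -> (forall A, A \in Q -> #|A|%:R <= K) ->
  dotv (beta_vec x p) (beta_vec x p) -
    blockdot Q (beta_vec x p) (beta_vec x p) <= 4 * K * C ^+ 2.
Proof.
move=> p0 K0 xC /and3P[/eqP covQ tQ Q0] ordQ QK.
have C0 : 0 <= C by apply: le_trans (xC 0); exact: normr_ge0.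
have QN0 A : A \in Q -> A != finset.set0 by apply: contraTneq => ->.
(* [ab A] holds the positions of the minimum and the maximum of x on the atom A; off [Q] it is a
   dummy pair, available because 0 < p. *)
have /choice[ab abP] : forall A, exists c : 'I_p * 'I_p, A \in Q ->
    [/\ c.1 \in A, c.2 \in A & forall k : 'I_p, k \in A -> x c.1 <= x k <= x c.2].
  move=> A; have [AQ|AQ] := boolP (A \in Q).
    by have [c] := finset_minmax x (QN0 _ AQ); exists c.
  by exists (Ordinal p0, Ordinal p0).
have xlu i : - C <= x i <= C by rewrite -ler_norml.
have osc : \sum_(A <- enum Q) (x (ab A).2 - x (ab A).1) <= C - - C.
  apply: nonoverlapping_sum_le => //; first exact: enum_uniq.
  - by lra.
  - move=> A; rewrite mem_enum => /abP[A1 A2 /(_ _ A2)/andP[? _]].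
    by split => //; [have /andP[] := xlu (ab A).1|have /andP[] := xlu (ab A).2].
  - move=> A B; rewrite !mem_enum => AQ BQ AB.
    have [? ? _] := abP _ AQ; have [? ? _] := abP _ BQ.
    by have [H|H] := ordQ _ _ AQ BQ AB; [left|right]; exact: H.
have -> : dotv (beta_vec x p) (beta_vec x p) = \sum_(A in Q) \sum_(i in A) x i ^+ 2.
  rewrite -finset.big_trivIset//= covQ /dotv; apply: eq_big => i; first by rewrite inE.
  by rewrite mxE.
rewrite /blockdot -sumrB.
have -> : 4 * K * C ^+ 2 = K * (2 * C) * (C - - C) by ring.
rewrite big_enum /= in osc.
apply: le_trans (ler_wpM2l _ osc); last by rewrite !mulr_ge0.
rewrite mulr_sumr; apply: ler_sum => A AQ.
have -> : \sum_(i in A) beta_vec x p i 0 = \sum_(i in A) x i.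
  by apply: eq_bigr => i _; rewrite mxE.
(* Centring at the minimum of the atom: in each squared deviation one factor is bounded by 2C and
   the other by the range of the atom. *)
apply: le_trans (sum_sqr_centered_le (fun i : 'I_p => x i) (x (ab A).1) (QN0 _ AQ)) _.
have [A1 A2 AP] := abP _ AQ.
apply: (@le_trans _ _ (\sum_(i in A) (2 * C) * (x (ab A).2 - x (ab A).1))).
  apply: ler_sum => i iA; have /andP[? ?] := AP _ iA.
  have /andP[? ?] := xlu (ab A).1; have /andP[? ?] := xlu i.
  by rewrite expr2; apply: ler_pM; lra.
rewrite sumr_const -[leLHS]mulr_natl -(mulrA K) ler_wpM2r ?QK// mulr_ge0 ?mulr_ge0//.
by have /andP[] := AP _ A2; lra.
Qed.

(** * Limit of the top eigenvalue *)

Section limits.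
Context {R : realType}.
Implicit Types (u v w : nat -> R) (l : R).

Lemma cvg_near_eq u v l : (\forall p \near \oo, u p = v p) ->
  u @ \oo --> l -> v @ \oo --> l.
Proof. by move=> /near_eq_cvg uv; apply: cvg_trans. Qed.

Lemma cvg_pos_eq u v l : (forall p, (0 < p)%N -> u p = v p) ->
  u @ \oo --> l -> v @ \oo --> l.
Proof.
by move=> uv; apply: cvg_near_eq; near=> p; apply: uv; near: p; exact: nbhs_infty_gt.
Unshelve. all: by end_near. Qed.

Lemma cvg_sqrt u l : u @ \oo --> l ->
  (fun p => Num.sqrt (u p)) @ \oo --> Num.sqrt l.
Proof. by move=> ul; apply: continuous_cvg => //; exact: sqrt_continuous. Qed.

Lemma cvg_sqr u l : u @ \oo --> l -> (fun p => u p ^+ 2) @ \oo --> l ^+ 2.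
Proof. by move=> ul; under eq_fun do rewrite expr2; exact: cvgM. Qed.

Lemma cvg_sqr0 u : (fun p => u p ^+ 2) @ \oo --> (0 : R) -> u @ \oo --> (0 : R).
Proof.
move=> /cvg_sqrt; rewrite sqrtr0.
under eq_fun do rewrite sqrtr_sqr.
by move=> /norm_cvg0P.
Qed.

(** Boundedness is expressed through a convergent majorant of the squares because v will be a score,
    whose square is at most the top eigenvalue. *)
Lemma cvg_mul_bounded u v w l :
  (forall p, (0 < p)%N -> v p ^+ 2 <= w p) -> w @ \oo --> l ->
  u @ \oo --> (0 : R) -> (fun p => u p * v p) @ \oo --> (0 : R).
Proof.
move=> vw wl u0; apply: cvg_sqr0.
apply: (@squeeze_cvgr _ _ _ _ (fun=> 0) (fun p => u p ^+ 2 * w p)).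
- near=> p; rewrite sqr_ge0 exprMn ler_wpM2l ?sqr_ge0 ?vw//.
  by near: p; exact: nbhs_infty_gt.
- exact: cvg_cst.
- have -> : 0 = 0 ^+ 2 * l by rewrite expr0n mul0r.
  by apply: cvgM => //; exact: cvg_sqr.
Unshelve. all: by end_near. Qed.

(** |G| tends to sqrt K, and a |G| - o tends to m sqrt K > 0. A negative G p would make this
    quantity nonpositive by the sign condition, so G is eventually nonnegative. This is how (h, q)
    >= 0 fixes the sign. *)
Lemma cvg_signed_sqrt (a G o : nat -> R) (m K : R) : 0 < m -> 0 < K ->
  a @ \oo --> m -> o @ \oo --> (0 : R) ->
  (fun p => G p ^+ 2) @ \oo --> K ->
  (\forall p \near \oo, 0 <= a p * G p + o p) -> G @ \oo --> Num.sqrt K.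
Proof.
move=> m0 K0 am o0 GK ge0.
have absG : (fun p => `|G p|) @ \oo --> Num.sqrt K.
  have := cvg_sqrt GK.
  by under eq_fun do rewrite sqrtr_sqr.
have sK : 0 < Num.sqrt K by rewrite sqrtr_gt0.
apply: (cvg_near_eq _ absG).
have H0 : (fun p => a p * `|G p| - o p) @ \oo --> m * Num.sqrt K.
  by rewrite -[X in _ --> X]subr0; apply: cvgB => //; exact: cvgM.
have H := cvgr_gt _ H0 _ (mulr_gt0 m0 sK).
near=> p; rewrite ger0_norm// leNgt; apply/negP => Gp.
have P1 : 0 < a p * `|G p| - o p by near: p; exact: H.
have P2 : 0 <= a p * G p + o p by near: p.
rewrite ltr0_norm// in P1; suff : (0 : R) < 0 by rewrite ltxx.
lra.
Unshelve. all: by end_near. Qed.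

End limits.

Section top_eigenvalue_limit.
Context {R : realType} {n : nat}.
Variables (a : 'I_n -> 'I_n -> nat -> R) (f : 'I_n -> R) (B D : R).
Variables (lam : nat -> R) (g : 'I_n -> nat -> R).
Let F := \sum_j f j ^+ 2.
Hypothesis B0 : 0 < B.
Hypothesis D0 : 0 <= D.
Hypothesis F0 : 0 < F.
Hypothesis cvg_a : forall j k, a j k @ \oo --> B * f j * f k + D * (j == k)%:R.
Hypothesis gg : forall p, (0 < p)%N -> \sum_j g j p ^+ 2 = lam p.
Hypothesis gag : forall p, (0 < p)%N ->
  lam p ^+ 2 = \sum_j \sum_k g j p * a j k p * g k p.
Hypothesis faf : forall p, (0 < p)%N ->
  \sum_j (\sum_k a j k p * f k) ^+ 2 <=
  lam p * \sum_j \sum_k f j * a j k p * f k.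

Let ainf j k := B * f j * f k + D * (j == k)%:R.
Let err p := \sum_j \sum_k `|a j k p - ainf j k|.

Let sum_delta (c : 'I_n -> R) j : \sum_k (j == k)%:R * c k = c j.
Proof.
rewrite (bigD1 j)//= eqxx mul1r big1 ?addr0// => k /negPf kj.
by rewrite eq_sym kj mul0r.
Qed.

Let ainf_quad (u : 'I_n -> R) : \sum_j \sum_k u j * ainf j k * u k =
  B * (\sum_j f j * u j) ^+ 2 + D * \sum_j u j ^+ 2.
Proof.
transitivity (\sum_j (u j * f j * B * \sum_k f k * u k + D * u j ^+ 2)).
  apply: eq_bigr => j _; rewrite expr2 -{4}(sum_delta u j) !mulr_sumr -big_split.
  by apply: eq_bigr => k _ /=; rewrite /ainf; ring.
rewrite big_split /= -mulr_sumr; congr (_ + _).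
rewrite expr2 mulrA [B * _]mulr_sumr mulr_suml; apply: eq_bigr => j _; ring.
Qed.

Let err_cvg : err @ \oo --> (0 : R).
Proof.
have -> : (0 : R) = \sum_(j < n) \sum_(k < n) 0.
  by rewrite big1// => j _; rewrite big1.
apply: cvg_sumr => j _; apply: cvg_sumr => k _.
by apply/norm_cvg0P; apply/subr_cvg0; exact: cvg_a.
Qed.

Let lam_ge0 p : (0 < p)%N -> 0 <= lam p.
Proof. by move=> /gg <-; apply: sumr_ge0 => j _; exact: sqr_ge0. Qed.

(** The matrix a is replaced by its limit in [gag]. The error in the quadratic form is at most
    [err p] times lam, since |g_j g_k| <= |g|^2 = lam. *)
Let quad_le p : (0 < p)%N ->
  lam p ^+ 2 <= B * (\sum_j f j * g j p) ^+ 2 + (D + err p) * lam p.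
Proof.
move=> p0; rewrite gag// mulrDl addrA -{1}gg//.
rewrite -(ainf_quad (g ^~ p)) -lerBlDl -sumrB /err mulr_suml.
apply: ler_sum => j _; rewrite -sumrB mulr_suml; apply: ler_sum => k _.
rewrite -mulrBl -mulrBr; apply: le_trans (ler_norm _) _.
rewrite !normrM mulrAC mulrC ler_wpM2l//.
have gl i : `|g i p| ^+ 2 <= lam p.
  rewrite real_normK ?num_real// -gg// (bigD1 i)//= lerDl.
  by apply: sumr_ge0 => *; exact: sqr_ge0.
have := gl j; have := gl k; have := sqr_ge0 (`|g j p| - `|g k p|).
rewrite sqrrB; lra.
Qed.

(** Lower bound: by [faf], lam is at least |a f|^2 / (f, a f), which tends to B F + D. Upper bound:
    [quad_le] with (f, g)^2 <= F lam, divided by lam, gives lam <= B F + D + err. *)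
Lemma cvg_top_eigenvalue : lam @ \oo --> B * F + D.
Proof.
have quad_f : (fun p => \sum_j \sum_k f j * a j k p * f k) @ \oo -->
    F * (B * F + D).
  have -> : F * (B * F + D) = \sum_j \sum_k f j * ainf j k * f k.
    rewrite ainf_quad; under eq_bigr do rewrite -expr2; rewrite -/F; ring.
  apply: cvg_sumr => j _; apply: cvg_sumr => k _.
  by apply: cvgMl; apply: cvgMr; exact: cvg_a.
have quad_f2 : (fun p => \sum_j (\sum_k a j k p * f k) ^+ 2) @ \oo -->
    F * (B * F + D) ^+ 2.
  have -> : F * (B * F + D) ^+ 2 = \sum_j (\sum_k ainf j k * f k) ^+ 2.
    rewrite mulr_suml; apply: eq_bigr => j _; rewrite -exprMn; congr (_ ^+ 2).
    transitivity (\sum_k (B * f j * f k ^+ 2 + D * ((j == k)%:R * f k))).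
      by rewrite big_split/= -!mulr_sumr sum_delta -/F; ring.
    by apply: eq_bigr => k _; rewrite /ainf; ring.
  apply: cvg_sumr => j _.
  have H : (fun p => \sum_k a j k p * f k) @ \oo --> \sum_k ainf j k * f k.
    by apply: cvg_sumr => k _; apply: cvgMl; exact: cvg_a.
  exact: cvg_sqr.
have L0 : 0 < B * F + D by rewrite ltr_wpDr// mulr_gt0.
have FL0 : 0 < F * (B * F + D) by rewrite mulr_gt0.
apply: (@squeeze_cvgr _ _ _ _ (fun p => (\sum_j (\sum_k a j k p * f k) ^+ 2) /
   \sum_j \sum_k f j * a j k p * f k) (fun p => B * F + D + err p)).
- near=> p; have p0 : (0 < p)%N by near: p; exact: nbhs_infty_gt.
  apply/andP; split.
    rewrite ler_pdivrMr ?faf//.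
    by near: p; exact: (cvgr_gt _ quad_f).
  have e0 : 0 <= err p.
    by apply: sumr_ge0 => j _; apply: sumr_ge0 => k _; exact: normr_ge0.
  have [l0|lN0] := eqVneq (lam p) 0; first by rewrite l0 addr_ge0// ltW.
  have lp : 0 < lam p by rewrite lt_neqAle eq_sym lN0 lam_ge0.
  rewrite -(ler_pM2r lp) -expr2; apply: le_trans (quad_le p0) _.
  have CS : (\sum_j f j * g j p) ^+ 2 <= F * lam p by rewrite -gg//; exact: sum_CS.
  by have := ler_wpM2l (ltW B0) CS; lra.
- have -> : B * F + D = F * (B * F + D) ^+ 2 / (F * (B * F + D)).
    by field; rewrite !gt_eqF.
  by apply: cvgM => //; apply: cvgV => //; rewrite gt_eqF.
- by rewrite -[X in _ --> X]addr0; apply: cvgD => //; exact: cvg_cst.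
Unshelve. all: by end_near. Qed.

(** [quad_le] solved for (f, g)^2 bounds it from below, Cauchy-Schwarz from above, and both bounds
    have the same limit: the scores become aligned with f. *)
Lemma cvg_top_eigvec_factor :
  (fun p => (\sum_j f j * g j p) ^+ 2) @ \oo --> F * (B * F + D).
Proof.
have lcvg := cvg_top_eigenvalue; set L := B * F + D in lcvg *.
apply: (@squeeze_cvgr _ _ _ _ (fun p => (lam p ^+ 2 - (D + err p) * lam p) / B)
  (fun p => F * lam p)).
- near=> p; have p0 : (0 < p)%N by near: p; exact: nbhs_infty_gt.
  rewrite -{3}gg// sum_CS andbT ler_pdivrMr// mulrC.
  by have := quad_le p0; lra.
- have -> : F * L = (L ^+ 2 - (D + 0) * L) / B.
    by rewrite /L; field; rewrite gt_eqF.
  apply: cvgMl; apply: cvgB; first exact: cvg_sqr.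
  by apply: cvgM => //; apply: cvgD => //; exact: cvg_cst.
- exact: cvgMr.
Unshelve. all: by end_near. Qed.

End top_eigenvalue_limit.

(** * The dual eigenproblem of fixed size n *)

Section scores.
Context {R : realType} {p n : nat}.
Variables (Y : 'M[R]_(p, n)) (h : 'cV[R]_p).
Hypotheses (p0 : (0 < p)%N) (n0 : (0 < n)%N).

(** Up to the factor n / p, [sample_cov Y] and the n by n Gram matrix have the same nonzero
    eigenvalues. The size n being fixed, limits of the Gram matrix can be taken entrywise. *)
Definition scaled_top : R := n%:R / p%:R * s2 Y.
Definition scaled_gram : 'M[R]_n := p%:R^-1 *: (Y^T *m Y).
Definition scores : 'cV[R]_n := (Num.sqrt p%:R)^-1 *: (Y^T *m h).

Let pN0 : p%:R != 0 :> R. Proof. by rewrite pnatr_eq0 -lt0n. Qed.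
Let nN0 : n%:R != 0 :> R. Proof. by rewrite pnatr_eq0 -lt0n. Qed.
Let sqr_rp : (Num.sqrt p%:R)^-1 * (Num.sqrt p%:R)^-1 = p%:R^-1 :> R.
Proof. by rewrite -invfM -expr2 sqr_sqrtr. Qed.

Lemma s2E : s2 Y = p%:R / n%:R * scaled_top.
Proof. by rewrite /scaled_top; field; rewrite pN0. Qed.

Lemma sample_cov_sym : (sample_cov Y)^T = sample_cov Y.
Proof. by rewrite linearZ /= trmx_mul trmxK. Qed.

(** The Rayleigh bound for [sample_cov Y] at the vector Y u, rescaled: (Y u, Y Y^T Y u) = |Y^T Y
    u|^2 and |Y u|^2 = (u, Y^T Y u). No comparison of the two spectra is involved. *)
Lemma rayleigh_scaled_top (u : 'cV[R]_n) :
  dotv (scaled_gram *m u) (scaled_gram *m u) <=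
  scaled_top * dotv u (scaled_gram *m u).
Proof.
have := rayleigh_le_lambda_max sample_cov_sym (Y *m u).
rewrite -/(s2 Y) s2E /sample_cov /scaled_gram -!scalemxAl !(dotvZl, dotvZr).
rewrite -!mulmxA (dotv_mulmx Y (Y *m u) (Y^T *m _)) (dotv_mulmx Y (Y *m u) u).
rewrite (dotvC (Y^T *m (Y *m u)) u).
set x := dotv (Y^T *m _) _; set y := dotv u _ => H.
have P : 0 < n%:R / p%:R ^+ 2 :> R by rewrite divr_gt0 ?exprn_gt0 ?ltr0n.
have := ler_wpM2l (ltW P) H.
rewrite [leLHS](_ : _ = p%:R^-1 * (p%:R^-1 * x)); last by field; rewrite pN0.
by rewrite [leRHS](_ : _ = scaled_top * (p%:R^-1 * y))//; field; rewrite pN0.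
Qed.

Lemma tr_sample_cov : \tr (sample_cov Y) = p%:R / n%:R * \tr scaled_gram.
Proof.
rewrite /sample_cov /scaled_gram !mxtraceZ (mxtrace_mulC Y).
by field; rewrite pN0.
Qed.

(** The trace is the same for both Gram matrices up to scale, so psi^2 becomes a function of two
    quantities with known limits, the trace and the top eigenvalue. *)
Lemma psi_ratioE : (1 < n)%N -> scaled_top != 0 ->
  (s2 Y - l2 Y) / s2 Y =
  1 - (\tr scaled_gram / scaled_top - 1) / n.-1%:R.
Proof.
move=> n1 tN0; rewrite /l2 tr_sample_cov s2E; field.
by rewrite tN0 pN0 nN0 !andbT pnatr_eq0 -lt0n -ltnS prednK.
Qed.

Hypothesis lead : leading_eigvec Y h.

Let hh : dotv h h = 1.
Proof. by have [_ h1 _] := lead; rewrite -enorm_sqr h1 expr1n. Qed.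

Lemma eigvec_scores :
  scaled_top *: h = (Num.sqrt p%:R)^-1 *: (Y *m scores).
Proof.
have [hE _ _] := lead.
rewrite /scores -scalemxAr scalerA sqr_rp /scaled_top -scalerA -hE.
rewrite /sample_cov -scalemxAl -mulmxA !scalerA; congr (_ *: _).
by field; rewrite pN0.
Qed.

Lemma scores_sqr : dotv scores scores = scaled_top.
Proof.
rewrite {1}/scores dotvZl -(dotv_mulmx Y) -dotvZr.
by rewrite -eigvec_scores dotvZr hh mulr1.
Qed.

Lemma dotv_eigvec (u : 'cV[R]_p) :
  scaled_top * dotv h u = (Num.sqrt p%:R)^-1 * dotv (Y *m scores) u.
Proof. by rewrite -dotvZl eigvec_scores dotvZl. Qed.

Lemma scaled_top_sqr : scaled_top ^+ 2 = dotv scores (scaled_gram *m scores).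
Proof.
rewrite -[LHS]mulr1 -hh expr2 -mulrA -dotvZr -dotvZl eigvec_scores.
rewrite dotvZl dotvZr mulrA sqr_rp -dotvZr /scaled_gram -scalemxAl -mulmxA.
by rewrite !dotvZr dotv_mulmx dotvC.
Qed.

End scores.

(** * Distance from the estimator to a unit vector *)

Section maps_distance.
Context {R : realType} {p n : nat}.
Variables (Y : 'M[R]_(p, n)) (h b : 'cV[R]_p) (L : {vspace 'cV[R]_p}).

(** For unit vectors |u - b|^2 = 2 - 2 (u, b). Here e = |proj h|^2, and e > 0 excludes the branch of
    [maps] where L is orthogonal to h; the second positivity condition says that the vector to be
    normalized is nonzero. *)
Lemma maps_distE : dotv h h = 1 -> dotv b b = 1 ->
  let t := tau Y h L in let e := dotv h (oproj L h) in
  0 < e -> 0 < t ^+ 2 + 2 * t * e + e ->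
  enorm (maps Y h L - b) = Num.sqrt (2 - 2 *
    ((t * dotv h b + dotv (oproj L h) b) / Num.sqrt (t ^+ 2 + 2 * t * e + e))).
Proof.
move=> h1 b1 t e e0 v0; rewrite /maps asboolF; last first.
  move=> H; have [wL _] := oprojP L h.
  by move: e0; rewrite /e dotvC H ?ltxx.
set v := tau Y h L *: h + _.
have vv : dotv v v = t ^+ 2 + 2 * t * e + e.
  rewrite /v !(dotvDl, dotvDr, dotvZl, dotvZr) h1 -dotv_oproj2.
  by rewrite (dotvC (oproj L h) h) -/e -/t; ring.
have vb : dotv v b = t * dotv h b + dotv (oproj L h) b.
  by rewrite dotvDl dotvZl.
rewrite -vv -vb -/(enorm v) {1}/enorm; congr Num.sqrt.
have v1 : 0 < enorm v by rewrite sqrtr_gt0 vv.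
rewrite /normalize !(dotvBr) !(dotvC _ b) !(dotvC (_ - _)) !dotvBr.
rewrite !(dotvZl, dotvZr) b1 (dotvC b v) -enorm_sqr.
by field; rewrite gt_eqF.
Qed.

End maps_distance.

(** * Limits of the mean square of beta and of its projection *)

Section beta_limits.
Context {R : realType} (x : nat -> R) (m r : R).
Hypothesis m0 : 0 < m.
Hypothesis mean_cvg : beta_mean x @ \oo --> m.
Hypothesis disp_cvg : beta_disp x @ \oo --> r.

(** The mean of the squares is the squared mean plus the variance, i.e. mu^2 (1 + d^2). The identity
    divides by mu, hence holds once mu is positive. *)
Lemma cvg_beta_sqr :
  (fun p => p%:R^-1 * dotv (beta_vec x p) (beta_vec x p)) @ \oo -->
  m ^+ 2 * (1 + r ^+ 2).
Proof.
apply: (@cvg_near_eq _ (fun p => beta_mean x p ^+ 2 * (1 + beta_disp x p ^+ 2))).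
  near=> p; have p0 : (0 < p)%N by near: p; exact: nbhs_infty_gt.
  have pN0 : p%:R != 0 :> R by rewrite pnatr_eq0 -lt0n.
  have mu0 : 0 < beta_mean x p by near: p; exact: (cvgr_gt _ mean_cvg).
  rewrite /beta_disp sqr_sqrtr; last first.
    by rewrite mulr_ge0// sumr_ge0// => i _; exact: sqr_ge0.
  set mu := beta_mean x p in mu0 *.
  have sx : \sum_(i < p) x i = p%:R * mu by rewrite /mu /beta_mean mulVKf.
  have -> : dotv (beta_vec x p) (beta_vec x p) = \sum_(i < p) x i ^+ 2.
    by apply: eq_bigr => i _; rewrite !mxE.
  have -> : \sum_(i < p) ((x i - mu) / mu) ^+ 2 =
      mu ^- 2 * (\sum_(i < p) x i ^+ 2 - 2 * mu * (p%:R * mu) + p%:R * mu ^+ 2).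
    rewrite -{1}sx (_ : p%:R * mu ^+ 2 = \sum_(i < p) mu ^+ 2); last first.
      by rewrite sumr_const card_ord mulr_natl.
    rewrite [2 * mu * _]mulr_sumr -sumrB -big_split mulr_sumr.
    by apply: eq_bigr => i _ /=; field; rewrite gt_eqF.
  by field; rewrite pN0 gt_eqF.
apply: cvgM; first exact: cvg_sqr.
by apply: cvgD; [exact: cvg_cst|exact: cvg_sqr].
Unshelve. all: by end_near. Qed.

(** Semi-uniformity allows K = M p / |Q p| in [ordered_partition_defect_le]; after division by p the
    defect is at most 4 M C^2 / |Q p|, which tends to 0. *)
Lemma cvg_beta_oproj (Q : forall p, {set {set 'I_p}}) (C : R) :
  (forall i, `|x i| <= C) ->
  (forall p, finset.partition (Q p) [set: 'I_p]%SET) ->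
  (forall p, ordered_partition x (Q p)) ->
  semi_uniform R Q -> (fun p => #|Q p|) @ \oo --> \oo ->
  (fun p => p%:R^-1 * dotv (beta_vec x p)
     (oproj (partition_space R (Q p)) (beta_vec x p))) @ \oo -->
  m ^+ 2 * (1 + r ^+ 2).
Proof.
move=> xC partQ ordQ [M M0 QM] Qoo.
have xx := cvg_beta_sqr; set B := m ^+ 2 * _ in xx *.
have kinv : (fun p => (#|Q p|%:R : R)^-1) @ \oo --> (0 : R).
  apply/gtr0_cvgV0 => //.
    near=> p; rewrite ltr0n; near: p.
    by move/cvgnyPge : Qoo => /(_ 1%N).
  by apply/cvgrnyP.
apply: (@squeeze_cvgr _ _ _ _ (fun p => p%:R^-1 * dotv (beta_vec x p) (beta_vec x p)
     - 4 * M * C ^+ 2 * (#|Q p|%:R)^-1)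
   (fun p => p%:R^-1 * dotv (beta_vec x p) (beta_vec x p))).
- near=> p; have p0 : (0 < p)%N by near: p; exact: nbhs_infty_gt.
  have pN0 : p%:R != 0 :> R by rewrite pnatr_eq0 -lt0n.
  have pi0 : 0 <= p%:R^-1 :> R by rewrite invr_ge0.
  rewrite (ler_wpM2l pi0 (dotv_oproj_le _ _)) andbT.
  have /and3P[_ tQ Q0] := partQ p.
  rewrite dotv_oproj_partition//.
  have K0 : 0 <= M * p%:R / #|Q p|%:R by rewrite divr_ge0// mulr_ge0// ltW.
  have := ordered_partition_defect_le p0 K0 xC (partQ p) (ordQ p).
  have QK A : A \in Q p -> #|A|%:R <= M * p%:R / #|Q p|%:R.
    by move=> AQ; apply: le_trans (QM p p0); rewrite ler_nat leq_bigmax_cond.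
  move=> /(_ QK) H; have := ler_wpM2l pi0 H.
  rewrite mulrBr (_ : p%:R^-1 * (4 * _ * _) = 4 * M * C ^+ 2 * #|Q p|%:R^-1); last first.
    by move: (#|Q p|%:R^-1 : R) => q; field.
  by lra.
- rewrite -[X in _ --> X]subr0 -[X in B - X](mulr0 (4 * M * C ^+ 2)).
  by apply: cvgB => //; exact: cvgMr.
- exact: xx.
Unshelve. all: by end_near. Qed.

End beta_limits.

(** * Convergence for a fixed outcome *)

(** The randomness enters only through the limits assumed for the noise: its averages, its Gram
    matrix and its projections. [D] is the noise variance; a nonzero entry of f makes the factor
    part of the limiting Gram matrix nonzero. *)
Lemma cvg_maps (R : realType) (n : nat) (x : nat -> R) (f : 'I_n -> R)
    (z : nat -> 'I_n -> R) (h : forall p, 'cV[R]_p)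
    (Q : forall p, {set {set 'I_p}}) (C m r D : R) :
  (1 < n)%N -> (exists j, f j <> 0) -> (forall i, `|x i| <= C) ->
  0 < m -> beta_mean x @ \oo --> m -> beta_disp x @ \oo --> r -> 0 < D ->
  (forall p, (0 < p)%N -> leading_eigvec (returns x f z p) (h p)) ->
  (forall p, finset.partition (Q p) [set: 'I_p]%SET) ->
  (forall p, ordered_partition x (Q p)) ->
  semi_uniform R Q -> (fun p => #|Q p|) @ \oo --> \oo ->
  (forall j, (fun p => p%:R^-1 * \sum_(i < p) x i * z i j) @ \oo --> (0 : R)) ->
  (forall j, (fun p => p%:R^-1 * \sum_(i < p) z i j) @ \oo --> (0 : R)) ->
  (forall j k, (fun p => p%:R^-1 * \sum_(i < p) z i j * z i k) @ \oo -->
     D * (j == k)%:R) ->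
  (forall j, (fun p => p%:R^-1 * blockdot (Q p) (\col_i z i j) (\col_i z i j))
     @ \oo --> (0 : R)) ->
  (fun p => enorm (maps (returns x f z p) (h p) (partition_space R (Q p)) -
     normalize (beta_vec x p))) @ \oo --> (0 : R).
Proof.
move=> n1 [j0 fj0] xC m0 mcvg rcvg D0 lead partQ ordQ Qunif Qoo xz z1 zz bzz.
have n0 : (0 < n)%N by exact: ltnW.
have nN1 : n.-1%:R != 0 :> R by rewrite pnatr_eq0 -lt0n -ltnS prednK.
pose B := m ^+ 2 * (1 + r ^+ 2).
have B0 : 0 < B by rewrite mulr_gt0 ?exprn_gt0// ltr_pwDl// sqr_ge0.
pose F := \sum_j f j ^+ 2.
have F0 : 0 < F.
  rewrite /F (bigD1 j0)//= ltr_pwDl//; last by apply: sumr_ge0 => *; exact: sqr_ge0.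
  by rewrite lt_neqAle sqr_ge0 andbT eq_sym sqrf_eq0; apply/eqP.
pose L p := partition_space R (Q p).
pose zc j p : 'cV[R]_p := \col_i z i j.
pose X p := beta_vec x p.
pose Y p := returns x f z p.
have xx : (fun p => p%:R^-1 * dotv (X p) (X p)) @ \oo --> B.
  exact: cvg_beta_sqr.
have bxx : (fun p => p%:R^-1 * dotv (X p) (oproj (L p) (X p))) @ \oo --> B.
  exact: (cvg_beta_oproj m0 mcvg rcvg xC).
have {}xz j : (fun p => p%:R^-1 * dotv (X p) (zc j p)) @ \oo --> (0 : R).
  apply: cvg_trans (xz j); apply: near_eq_cvg; near=> p; congr (_ * _).
  by apply: eq_bigr => i _; rewrite !mxE.
have {}zz j k : (fun p => p%:R^-1 * dotv (zc j p) (zc k p)) @ \oo --> D * (j == k)%:R.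
  apply: cvg_trans (zz j k); apply: near_eq_cvg; near=> p; congr (_ * _).
  by apply: eq_bigr => i _; rewrite !mxE.
have {}bzz j : (fun p => p%:R^-1 * dotv (zc j p) (oproj (L p) (zc j p))) @ \oo -->
    (0 : R).
  apply: cvg_trans (bzz j); apply: near_eq_cvg; near=> p; congr (_ * _).
  by have /and3P[_ tQ Q0] := partQ p; rewrite -dotv_oproj_partition.
(* Cauchy-Schwarz for the form (u, proj v): the projected noise columns are negligible against any u
   whose projection is O(sqrt p). *)
have bCS (u : forall p, 'cV[R]_p) (l : R) j :
    (fun p => p%:R^-1 * dotv (u p) (oproj (L p) (u p))) @ \oo --> l ->
    (fun p => p%:R^-1 * dotv (u p) (oproj (L p) (zc j p))) @ \oo --> (0 : R).
  move=> ul; apply: cvg_sqr0.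
  apply: (@squeeze_cvgr _ _ _ _ (fun=> 0) (fun p =>
    (p%:R^-1 * dotv (u p) (oproj (L p) (u p))) *
    (p%:R^-1 * dotv (zc j p) (oproj (L p) (zc j p))))).
  - near=> p; apply/andP; split; first exact: sqr_ge0.
    rewrite exprMn [leRHS]mulrACA -[X in _ <= X * _]expr2.
    by apply: ler_wpM2l (oproj_CS _ _ _); exact: sqr_ge0.
  - exact: cvg_cst.
  - by rewrite -(mulr0 l); apply: cvgM.
have bxz j := bCS X _ j bxx.
have bzz' j k := bCS (zc j) _ k (bzz j).
pose lam p := scaled_top (Y p).
pose g j p := scores (Y p) (h p) j 0.
pose G p := \sum_j f j * g j p.
have Ysc p (u : 'cV[R]_n) :
    Y p *m u = (\sum_j f j * u j 0) *: X p + \sum_j u j 0 *: zc j p.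
  rewrite /Y /returns mulmxDl; congr (_ + _).
    apply/colP => i; rewrite !mxE mulr_suml; apply: eq_bigr => j _.
    by rewrite mxE big_ord1 !mxE; ring.
  apply/colP => i; rewrite summxE !mxE; apply: eq_bigr => j _.
  by rewrite !mxE mulrC.
pose a j k p := scaled_gram (Y p) j k.
have acvg j k : a j k @ \oo --> B * f j * f k + D * (j == k)%:R.
  apply: (@cvg_near_eq _ (fun p => p%:R^-1 * dotv (X p) (X p) * f j * f k +
     (f j * (p%:R^-1 * dotv (X p) (zc k p)) + f k * (p%:R^-1 * dotv (X p) (zc j p))) +
     p%:R^-1 * dotv (zc j p) (zc k p))).
    near=> p; rewrite /a /scaled_gram !mxE.
    have -> : \sum_i (Y p)^T j i * Y p i k =
        dotv (f j *: X p + zc j p) (f k *: X p + zc k p).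
      by apply: eq_bigr => i _; rewrite !mxE !big_ord1 !mxE; ring.
    by rewrite !(dotvDl, dotvDr, dotvZl, dotvZr) (dotvC (zc j p) (X p)); ring.
  rewrite (_ : B * f j * f k = B * f j * f k + (f j * 0 + f k * 0)); last by ring.
  apply: cvgD => //; apply: cvgD; first by do 2 apply: cvgMl.
  by apply: cvgD; apply: cvgMr.
have glam p : (0 < p)%N -> \sum_j g j p ^+ 2 = lam p.
  move=> p0; rewrite -[RHS](scores_sqr p0 n0 (lead p p0)).
  by apply: eq_bigr => j _; rewrite expr2.
have gag p : (0 < p)%N -> lam p ^+ 2 = \sum_j \sum_k g j p * a j k p * g k p.
  move=> p0; rewrite [LHS](scaled_top_sqr p0 n0 (lead p p0)); apply: eq_bigr => j _.
  rewrite [(_ *m _) j 0]mxE mulr_sumr.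
  by apply: eq_bigr => k _; rewrite mulrA.
have faf p : (0 < p)%N -> \sum_j (\sum_k a j k p * f k) ^+ 2 <=
    lam p * \sum_j \sum_k f j * a j k p * f k.
  move=> p0; have := rayleigh_scaled_top (Y p) p0 n0 (\col_j f j).
  have Af j : (scaled_gram (Y p) *m \col_j f j) j 0 = \sum_k a j k p * f k.
    by rewrite mxE; apply: eq_bigr => k _; rewrite [(\col_j f j) k 0]mxE.
  congr (_ <= _ * _); apply: eq_bigr => j _; rewrite Af; first by rewrite expr2.
  rewrite [(\col_j f j) j 0]mxE mulr_sumr.
  by apply: eq_bigr => k _; rewrite mulrA.
pose Loo := B * F + D.
have L0 : 0 < Loo by rewrite addr_gt0// mulr_gt0.
have lamcvg : lam @ \oo --> Loo.
  exact: (cvg_top_eigenvalue B0 (ltW D0) F0 acvg glam gag faf).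
have G2cvg : (fun p => G p ^+ 2) @ \oo --> F * Loo.
  exact: (cvg_top_eigvec_factor B0 (ltW D0) F0 acvg glam gag faf).
have gvanish j u : u @ \oo --> (0 : R) -> (fun p => u p * g j p) @ \oo --> (0 : R).
  move=> u0; apply: (cvg_mul_bounded _ lamcvg u0) => p p0.
  rewrite -glam// (bigD1 j)//= lerDl.
  by apply: sumr_ge0 => *; exact: sqr_ge0.
have gsum (u : 'I_n -> nat -> R) : (forall j, u j @ \oo --> (0 : R)) ->
    (fun p => \sum_j u j p * g j p) @ \oo --> (0 : R).
  move=> u0; rewrite [X in _ --> X](_ : 0 = \sum_(j < n) 0); last by rewrite big1.
  by apply: cvg_sumr => j _; exact: gvanish.
have FL0 : 0 < F * Loo by rewrite mulr_gt0.
(* Inner products with h are reduced to inner products with x and the noise columns, weighted by [G]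
   and by the scores. *)
have hdot p (u : 'cV[R]_p) : (0 < p)%N ->
    lam p * ((Num.sqrt p%:R)^-1 * dotv (h p) u) =
    p%:R^-1 * dotv (X p) u * G p + \sum_j p%:R^-1 * dotv (zc j p) u * g j p.
  move=> p0; rewrite mulrCA (dotv_eigvec p0 n0 (lead p p0)) mulrA -invfM -expr2.
  rewrite sqr_sqrtr// Ysc -/(G p) dotvDl dotvZl dotv_suml mulrDr; congr (_ + _).
    by ring.
  by rewrite mulr_sumr; apply: eq_bigr => j _; rewrite dotvZl mulrCA mulrC.
(* [hdot] at the all-ones vector writes lam (h, q) as the mean of beta times [G] plus a vanishing
   term, so the sign convention makes [G] eventually nonnegative. *)
have Gcvg : G @ \oo --> Num.sqrt (F * Loo).
  apply: (cvg_signed_sqrt m0 FL0 mcvg (gsum _ z1) G2cvg).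
  near=> p; have p0 : (0 < p)%N by near: p; exact: nbhs_infty_gt.
  have [_ _ hq] := lead p p0.
  have lam0 : 0 <= lam p by rewrite -glam// sumr_ge0// => *; exact: sqr_ge0.
  have := mulr_ge0 lam0 hq; congr (0 <= _).
  have rp0 : Num.sqrt p%:R != 0 :> R by rewrite sqrtr_eq0 -ltNge ltr0n.
  have dotq (u : 'cV[R]_p) : dotv u (qvec R p) =
      (Num.sqrt p%:R)^-1 * dotv u (const_mx 1).
    by rewrite -dotvZr; congr dotv; apply/colP => i; rewrite !mxE mulr1.
  rewrite dotq hdot//; congr (_ * _ + _).
    by congr (_ * _); apply: eq_bigr => i _; rewrite !mxE mulr1.
  apply: eq_bigr => j _; congr (_ * _ * _).
  by apply: eq_bigr => i _; rewrite !mxE mulr1.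
set gam := Num.sqrt (F * Loo) in Gcvg.
have gam2 : gam ^+ 2 = F * Loo by rewrite sqr_sqrtr// ltW.
have gam0 : 0 < gam by rewrite sqrtr_gt0.
pose rt p : R := (Num.sqrt p%:R)^-1.
have lamV : (fun p => (lam p)^-1) @ \oo --> Loo^-1.
  by apply: cvgV => //; rewrite gt_eqF.
have lam_gt0 : \forall p \near \oo, 0 < lam p by exact: (cvgr_gt _ lamcvg).
have solve_lam (u v : nat -> R) (l : R) : (forall p, (0 < p)%N -> lam p * u p = v p) ->
    v @ \oo --> l -> u @ \oo --> l / Loo.
  move=> uv vl; apply: (@cvg_near_eq _ (fun p => v p / lam p)).
    near=> p; rewrite -uv 1?mulrC ?mulKf//; last by near: p; exact: nbhs_infty_gt.
    by rewrite gt_eqF//; near: p.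
  exact: cvgM.
have cvg_hdot (u : forall p, 'cV[R]_p) (l : R) :
    (fun p => p%:R^-1 * dotv (X p) (u p)) @ \oo --> l ->
    (forall j, (fun p => p%:R^-1 * dotv (zc j p) (u p)) @ \oo --> (0 : R)) ->
    (fun p => rt p * dotv (h p) (u p)) @ \oo --> l * gam / Loo.
  move=> ul zul; apply: solve_lam (fun p p0 => hdot p (u p) p0) _.
  rewrite -[X in _ --> X]addr0; apply: cvgD; first exact: cvgM.
  exact: gsum.
have hX : (fun p => rt p * dotv (h p) (X p)) @ \oo --> B * gam / Loo.
  by apply: cvg_hdot => // j; under eq_fun do rewrite dotvC; exact: xz.
have PhX : (fun p => rt p * dotv (h p) (oproj (L p) (X p))) @ \oo --> B * gam / Loo.
  by apply: cvg_hdot => // j; under eq_fun do rewrite dotv_oprojC; exact: bxz.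
have PhZ j : (fun p => rt p * dotv (h p) (oproj (L p) (zc j p))) @ \oo --> (0 : R).
  rewrite (_ : 0 = 0 * gam / Loo); last by rewrite !mul0r.
  by apply: cvg_hdot => [|k]; [exact: bxz|exact: bzz'].
(* One copy of h is expanded into scores, and the projection is moved onto x and the noise columns
   by self-adjointness; gam^2 = F Loo identifies the limit. *)
have Phh : (fun p => dotv (h p) (oproj (L p) (h p))) @ \oo --> B * F / Loo.
  have -> : B * F / Loo = B * gam / Loo * gam / Loo.
    transitivity (B * gam ^+ 2 / Loo ^+ 2); last by field; rewrite gt_eqF.
    by rewrite gam2; field; rewrite gt_eqF.
  apply: (solve_lam _ (fun p => rt p * dotv (h p) (oproj (L p) (X p)) * G p +
      \sum_j rt p * dotv (h p) (oproj (L p) (zc j p)) * g j p)).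
    move=> p p0; rewrite [LHS](dotv_eigvec p0 n0 (lead p p0)) Ysc -/(G p).
    rewrite dotvDl dotvZl dotv_suml mulrDr dotv_oprojC mulrC mulrAC; congr (_ + _).
      by rewrite /rt; ring.
    rewrite mulr_sumr; apply: eq_bigr => j _.
    by rewrite dotvZl dotv_oprojC -/(g j p) /rt; ring.
  rewrite -[X in _ --> X]addr0; apply: cvgD; first exact: cvgM.
  exact: gsum.
(* The common limit of psi^2 and |proj h|^2. Since 1 - rho = D / Loo > 0, the denominator of [tau]
   stays away from 0. Its square root is the limit of both (h, b) and (proj h, b). *)
pose rho := B * F / Loo.
have rho0 : 0 < rho by rewrite divr_gt0// mulr_gt0.
have rhoE : 1 - rho = D / Loo by rewrite /rho /Loo; field; rewrite gt_eqF.
have sB_gt0 : 0 < Num.sqrt B by rewrite sqrtr_gt0.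
have srhoE : Num.sqrt rho = B * gam / Loo / Num.sqrt B.
  rewrite -[RHS]ger0_norm; last first.
    by apply/ltW/divr_gt0 => //; apply: divr_gt0 => //; exact: mulr_gt0.
  rewrite -sqrtr_sqr; congr Num.sqrt.
  transitivity (B ^+ 2 * gam ^+ 2 / Loo ^+ 2 / Num.sqrt B ^+ 2).
    by rewrite gam2 (sqr_sqrtr (ltW B0)) /rho; field; rewrite !gt_eqF.
  by field; rewrite !gt_eqF.
have normX : (fun p => Num.sqrt (p%:R^-1 * dotv (X p) (X p))) @ \oo --> Num.sqrt B.
  exact: cvg_sqrt.
have sB0 : Num.sqrt B != 0 by rewrite gt_eqF// sqrtr_gt0.
have normalizeE p (u : 'cV[R]_p) : dotv u (normalize (X p)) =
    rt p * dotv u (X p) / Num.sqrt (p%:R^-1 * dotv (X p) (X p)).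
  (* At p = 0 all sums are empty; including this case lets the identity be rewritten under the
     sequence. *)
  have [p0|p0] := posnP p.
    by rewrite /dotv; subst p; rewrite !big_ord0 !mulr0 mul0r.
  have rp0 : Num.sqrt p%:R != 0 :> R by rewrite sqrtr_eq0 -ltNge ltr0n.
  rewrite dotvZr sqrtrM ?invr_ge0// sqrtrV// -/(enorm (X p)) invfM mulrC.
  by rewrite invrK mulrA [rt p * _]mulrC -!mulrA /rt mulKf.
have hb : (fun p => dotv (h p) (normalize (X p))) @ \oo --> Num.sqrt rho.
  rewrite srhoE; under eq_fun do rewrite normalizeE.
  by apply: cvgM => //; exact: cvgV.
have Phb : (fun p => dotv (oproj (L p) (h p)) (normalize (X p))) @ \oo --> Num.sqrt rho.
  rewrite srhoE; under eq_fun do rewrite normalizeE dotvC dotv_oprojC.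
  by apply: cvgM => //; exact: cvgV.
have psicvg : (fun p => psi (Y p) ^+ 2) @ \oo --> rho.
  rewrite -(sqr_sqrtr (ltW rho0)); apply/cvg_sqr/cvg_sqrt.
  apply: (@cvg_near_eq _ (fun p => 1 - ((\sum_j a j j p) / lam p - 1) / n.-1%:R)).
    near=> p; have p0 : (0 < p)%N by near: p; exact: nbhs_infty_gt.
    by rewrite psi_ratioE// -/(lam p) gt_eqF//; near: p.
  (* The trace tends to B F + n D = Loo + (n - 1) D, so the subtracted quotient is D / Loo = 1 -
     rho. *)
  have -> : rho = 1 - ((B * F + n%:R * D) / Loo - 1) / n.-1%:R.
    rewrite -[X in X%:R * D](prednK n0) -natr1 /rho /Loo.
    by field; rewrite nN1 gt_eqF.
  apply: cvgB; first exact: cvg_cst.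
  apply: cvgMl; apply: cvgB; last exact: cvg_cst.
  apply: cvgM => //.
  have -> : B * F + n%:R * D = \sum_j (B * f j * f j + D * (j == j)%:R).
    rewrite big_split /= mulr_sumr; congr (_ + _).
      by apply: eq_bigr => j _; rewrite expr2 mulrA.
    under eq_bigr do rewrite eqxx mulr1.
    by rewrite sumr_const card_ord mulr_natl.
  by apply: cvg_sumr => j _; exact: acvg.
have taucvg : (fun p => tau (Y p) (h p) (L p)) @ \oo --> (0 : R).
  rewrite (_ : 0 = (rho - rho) / (1 - rho)); last by rewrite subrr mul0r.
  apply: cvgM.
    apply: cvgB => //.
    by under eq_fun do rewrite enorm_sqr -dotv_oproj2.
  apply: cvgV; first by rewrite rhoE gt_eqF// divr_gt0.
  by apply: cvgB => //; exact: cvg_cst.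
have vvcvg : (fun p => tau (Y p) (h p) (L p) ^+ 2 + 2 * tau (Y p) (h p) (L p) *
    dotv (h p) (oproj (L p) (h p)) + dotv (h p) (oproj (L p) (h p))) @ \oo --> rho.
  rewrite (_ : rho = 0 ^+ 2 + 2 * 0 * rho + rho); last by ring.
  apply: cvgD => //; apply: cvgD; first exact: cvg_sqr.
  by apply: cvgM => //; exact: cvgMr.
apply: (@cvg_near_eq _ (fun p => Num.sqrt (2 - 2 *
    ((tau (Y p) (h p) (L p) * dotv (h p) (normalize (X p)) +
      dotv (oproj (L p) (h p)) (normalize (X p))) /
     Num.sqrt (tau (Y p) (h p) (L p) ^+ 2 + 2 * tau (Y p) (h p) (L p) *
    dotv (h p) (oproj (L p) (h p)) + dotv (h p) (oproj (L p) (h p))))))).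
  near=> p; have p0 : (0 < p)%N by near: p; exact: nbhs_infty_gt.
  have xx0 : 0 < p%:R^-1 * dotv (X p) (X p) by near: p; exact: (cvgr_gt _ xx).
  rewrite maps_distE//.
  - by have [_ h1 _] := lead p p0; rewrite -enorm_sqr h1 expr1n.
  - rewrite /normalize dotvZl dotvZr mulrA -invfM -expr2 enorm_sqr mulVf//.
    by apply: contraTneq xx0 => ->; rewrite mulr0 ltxx.
  - by near: p; exact: (cvgr_gt _ Phh).
  - by near: p; exact: (cvgr_gt _ vvcvg).
(* As tau vanishes, both the inner product with b and the norm of the unnormalized vector tend to
   sqrt rho, so the cosine tends to 1. *)
rewrite (_ : 0 = Num.sqrt (2 - 2 * ((0 * Num.sqrt rho + Num.sqrt rho) /
    Num.sqrt rho))); last first.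
  rewrite mul0r add0r divff ?mulr1 ?subrr ?sqrtr0//.
  by rewrite gt_eqF// sqrtr_gt0.
apply: cvg_sqrt; apply: cvgB; first exact: cvg_cst.
apply: cvgMr; apply: cvgM; last first.
  by apply: cvgV; [rewrite gt_eqF// sqrtr_gt0|exact: cvg_sqrt].
by apply: cvgD => //; exact: cvgM.
Unshelve. all: by end_near. Qed.

(** * Real expectations and independence *)

Section real_expectation.
Context d (T : measurableType d) (R : realType) (P : probability T R).
Implicit Types X Y : T -> R.

Definition integ X : Prop := P.-integrable setT (EFin \o X).

Lemma integ_measurable X : integ X -> measurable_fun setT X.
Proof. by move=> /measurable_int/measurable_EFinP. Qed.

Lemma integ_dominated X Y : measurable_fun setT X ->
  (forall w, `|X w| <= Y w) -> integ Y -> integ X.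
Proof.
move=> mX XY; apply: le_integrable => //; first exact/measurable_EFinP.
by move=> w _ /=; rewrite lee_fin (le_trans (XY w))// ler_norm.
Qed.

Lemma integ_cst (c : R) : integ (fun=> c).
Proof. exact: finite_measure_integrable_cst. Qed.

Lemma integD X Y : integ X -> integ Y -> integ (fun w => X w + Y w).
Proof. by move=> iX iY; exact: (integrableD measurableT iX iY). Qed.

Lemma integZ (c : R) X : integ X -> integ (fun w => c * X w).
Proof. by move=> iX; exact: (integrableZl measurableT c iX). Qed.

Lemma integ_sum (I : Type) (s : seq I) (D : pred I) (X : I -> T -> R) :
  (forall i, D i -> integ (X i)) -> integ (fun w => \sum_(i <- s | D i) X i w).
Proof.
move=> iX; elim: s => [|i s IH].
  have -> : (fun w => \sum_(i <- [::] | D i) X i w) = cst 0.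
    by apply/funext => w; rewrite big_nil.
  exact: integ_cst.
have -> : (fun w => \sum_(i <- i :: s | D i) X i w) =
    (fun w => if D i then X i w + \sum_(i <- s | D i) X i w
              else \sum_(i <- s | D i) X i w).
  by apply/funext => w; rewrite big_cons.
by case: (boolP (D i)) => // Di; apply: integD => //; exact: iX.
Qed.

Lemma Rintegral_sum (I : Type) (s : seq I) (D : pred I) (X : I -> T -> R) :
  (forall i, D i -> integ (X i)) ->
  \int[P]_w (\sum_(i <- s | D i) X i w) = \sum_(i <- s | D i) \int[P]_w X i w.
Proof.
move=> iX; elim: s => [|i s IH].
  under eq_Rintegral do rewrite big_nil.
  by rewrite big_nil Rintegral_cst// mul0r.
under eq_Rintegral do rewrite big_cons.
rewrite big_cons; case: (boolP (D i)) => // Di.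
by rewrite RintegralD ?IH//; [exact: iX|exact: integ_sum].
Qed.

Lemma Rintegral_fineK X : integ X -> (\int[P]_w (X w)%:E = (\int[P]_w X w)%:E)%E.
Proof. by move=> iX; rewrite /Rintegral fineK//; exact: integrable_fin_num. Qed.

Lemma integ_mul X Y : measurable_fun setT X -> measurable_fun setT Y ->
  integ (fun w => X w ^+ 2) -> integ (fun w => Y w ^+ 2) ->
  integ (fun w => X w * Y w).
Proof.
move=> mX mY iX iY; apply: (@integ_dominated _ (fun w => X w ^+ 2 + Y w ^+ 2)).
- exact: measurable_funM.
- move=> w; rewrite normrM.
  rewrite -(real_normK (num_real (X w))) -(real_normK (num_real (Y w))).
  have := sqr_ge0 (`|X w| - `|Y w|); rewrite sqrrB.
  by have := sqr_ge0 `|X w|; have := sqr_ge0 `|Y w|; lra.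
- exact: integD.
Qed.

End real_expectation.

Section independence.
Context d (T : measurableType d) (R : realType) (P : probability T R).

Definition indep_sets (F G : set (set T)) : Prop :=
  forall A B, F A -> G B -> (P (A `&` B) = P A * P B)%E.

(** For a fixed B in G, the finite measures P(A and B) and P(A) P(B) of A agree on the pi-system F,
    hence on the sigma-algebra it generates. *)
Lemma indep_sets_generated (F G : set (set T)) :
  setI_closed F -> F setT -> F `<=` measurable -> G `<=` measurable ->
  indep_sets F G -> indep_sets <<s F >> G.
Proof.
move=> FI FT Fm Gm FG A B FA GB.
have mB : measurable B by exact: Gm.
have PB : P B \is a fin_num by exact: fin_num_measure.
have PB0 : 0 <= fine (P B) by rewrite fine_ge0.
pose m1 := mrestr P mB; pose m2 := mscale (NngNum PB0) P.
have -> : (P A * P B = m2 A)%E by rewrite /m2 /mscale/= fineK// muleC.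
apply: (g_sigma_algebra_measure_unique F Fm (fun=> setT) _ _
  (mrestr P mB) (mscale (NngNum PB0) P)) => //.
- by rewrite bigcup_const//; exists 0%N.
- move=> C FC; change (P (C `&` B) = ((fine (P B))%:E * P C)%E).
  by rewrite fineK// muleC FG.
- move=> _; change (P (setT `&` B) < +oo)%E.
  by rewrite -ge0_fin_numE// fin_num_measure//; exact: measurableI.
Qed.

Definition group_sigma (I : Type) (D : set I) (F : I -> set (set T)) : set (set T) :=
  <<s \bigcup_(i in D) F i >>.

(** Needed to separate a partial sum from the next summand in the fourth moment induction. *)
Lemma indep_group (I : choiceType) (F : I -> set (set T)) (D : set I) (j : I) :
  (forall i, sigma_algebra setT (F i)) -> (forall i, F i `<=` measurable) ->
  mutual_indep P F -> ~ D j -> indep_sets (group_sigma D F) (F j).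
Proof.
move=> sF Fm iF Dj.
have FT i : F i setT.
  by have [F0 FC _] := sF i; rewrite -(setD0 setT); exact: FC.
have FI i A B : F i A -> F i B -> F i (A `&` B).
  by rewrite -(measurable_g_measurableTypeE (sF i)) => *; exact: measurableI.
(* finite intersections of events of the [F i] form a pi-system generating
   the sigma-algebra of the group *)
pose G := [set A | exists s : seq I, exists E : I -> set T,
  [/\ uniq s, forall i, i \in s -> D i, forall i, F i (E i) &
      A = \bigcap_(i in [set` s]) E i]].
have Gm : G `<=` measurable.
  move=> _ [s [E [us sD FE ->]]]; apply: fin_bigcap_measurable => // i _.
  exact/Fm/FE.
have GFj : indep_sets <<s G >> (F j).
  apply: indep_sets_generated => //.
  - move=> _ _ [s [E [us sD FE ->]]] [s' [E' [us' sD' FE' ->]]].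
    (* The two index lists are merged; an event is padded with [setT] at indices absent from its own
       list. *)
    exists (undup (s ++ s')), (fun i => (if i \in s then E i else setT) `&`
      (if i \in s' then E' i else setT)); split.
    + exact: undup_uniq.
    + by move=> i; rewrite mem_undup mem_cat => /orP[/sD|/sD'].
    + by move=> i; apply: FI; case: ifP.
    + apply/seteqP; split => [w [Ew E'w] i /=|w Ew].
        by move=> _; split; case: ifPn => // is_; [exact: Ew|exact: E'w].
      by split => i /= is_; have /= := Ew i;
        rewrite mem_undup mem_cat is_ ?orbT /= => /(_ isT)[].
  - exists [::], (fun=> setT); split => //.
    by apply/seteqP; split.
  - move=> _ B [s [E [us sD FE ->]]] FB.
    have js : j \notin s by apply/negP => /sD.
    pose E' i := if i == j then B else E i.
    have FE' i : F i (E' i) by rewrite /E'; case: eqP => [->|].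
    have EE' i : i \in s -> E' i = E i.
      by move=> is_; rewrite /E' ifN//; apply: contraNneq js => <-.
    have := iF (j :: s) E'; rewrite /= js us => /(_ isT (fun i _ => FE' i)).
    have -> : \bigcap_(i in [set` j :: s]) E' i = (\bigcap_(i in [set` s]) E i) `&` B.
      apply/seteqP; split => [w Ew|w [Ew Bw] i /=].
        split; last by have := Ew j; rewrite /= mem_head /E' eqxx => /(_ isT).
        by move=> i is_; rewrite -EE'//; apply: Ew; rewrite /= inE (is_ : i \in s) orbT.
      by rewrite inE /E'; case: eqP => [-> //|_ /= is_]; exact: Ew.
    rewrite big_cons {1}/E' eqxx => ->; rewrite muleC; congr (_ * _)%E.
    rewrite big_seq; under eq_bigr => i is_ do rewrite EE'//; rewrite -big_seq.
    by rewrite -iF// => i _.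
move=> A B FA FB; apply: GFj => //.
apply: smallest_sub FA; first exact: smallest_sigma_algebra.
move=> C [i Di FC]; apply: sub_sigma_algebra.
exists [:: i], (fun k => if k == i then C else setT); split => //.
- by move=> k; rewrite inE => /eqP ->.
- by move=> k; case: eqP => [->|].
- apply/seteqP; split => [w Cw k /=|w /(_ i)/=].
    by rewrite inE => /eqP ->; rewrite eqxx.
  by rewrite inE eqxx; apply.
Qed.

(** By independence on rectangles, the joint law of (X, Y) is the product of the two laws; Tonelli
    then gives integrability of the product and Fubini its value. *)
Lemma integ_indep (X Y : T -> R) :
  (forall A B, measurable A -> measurable B ->
    (P (X @^-1` A `&` Y @^-1` B) = P (X @^-1` A) * P (Y @^-1` B))%E) ->
  integ P X -> integ P Y ->
  integ P (fun w => X w * Y w) /\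
  \int[P]_w (X w * Y w) = (\int[P]_w X w) * (\int[P]_w Y w).
Proof.
move=> XY iX iY; have mX := integ_measurable iX; have mY := integ_measurable iY.
pose X' : {mfun T >-> R} := mfun_Sub (mem_set mX).
pose Y' : {mfun T >-> R} := mfun_Sub (mem_set mY).
have mXY : measurable_fun setT (fun w => (X w, Y w)) by exact: measurable_fun_pair.
pose XY' : {mfun T >-> (R * R)%type} := mfun_Sub (mem_set mXY).
pose m1 := distribution P X'; pose m2 := distribution P Y'.
pose m := distribution P XY'.
have mE A : measurable A -> (m1 \x m2)%E A = m A.
  by apply: product_measure_unique => B C mB mC; rewrite /m /m1 /m2 /distribution/= -XY.
pose f (xy : R * R) := (xy.1 * xy.2)%:E.
have mf : measurable_fun setT f.
  apply/measurable_EFinP.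
  by apply: measurable_funM; [exact: measurable_fst|exact: measurable_snd].
have mid : measurable_fun [set: R] (EFin \o id : R -> \bar R).
  by apply/measurable_EFinP; exact: measurable_id.
have i1 : m1.-integrable setT (EFin \o id : R -> \bar R).
  exact: (@integrable_pushforward _ _ _ _ _ X mX P setT _ mid).
have i2 : m2.-integrable setT (EFin \o id : R -> \bar R).
  exact: (@integrable_pushforward _ _ _ _ _ Y mY P setT _ mid).
have E1 : (\int[m1]_x x%:E = (\int[P]_w X w)%:E)%E.
  rewrite -Rintegral_fineK//.
  exact: (@integral_pushforward _ _ _ _ _ X mX P setT (EFin \o id)).
have E2 : (\int[m2]_x x%:E = (\int[P]_w Y w)%:E)%E.
  rewrite -Rintegral_fineK//.
  exact: (@integral_pushforward _ _ _ _ _ Y mY P setT (EFin \o id)).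
have imf : (m1 \x m2)%E.-integrable setT f.
  apply/integrable12ltyP => //.
  rewrite (eq_integral (fun x : R => `|x%:E| * \int[m2]_y `|y%:E|)%E); last first.
    move=> x _; rewrite -ge0_integralZl//.
      by apply: eq_integral => y _; rewrite /f/= normrM EFinM.
    by apply: measurableT_comp => //.
  have /integrableP[_ l1] := i1; have /integrableP[_ l2] := i2.
  rewrite ge0_integralZr//.
    by rewrite lte_mul_pinfty// ?ge0_fin_numE// ?integral_ge0.
  - exact: measurableT_comp.
  - exact: integral_ge0.
have imf' : m.-integrable setT f.
  have /integrableP[_ l] := imf; apply/integrableP; split => //.
  by rewrite (eq_measure_integral (m1 \x m2)%E) => [|A mA _]; [|exact/esym/mE].
have iXY : integ P (fun w => X w * Y w).
  apply/integrableP; split; first by apply/measurable_EFinP; exact: measurable_funM.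
  have /integrableP[_] := imf'.
  by rewrite ge0_integral_pushforward//; exact: measurableT_comp.
split => //; apply: EFin_inj; rewrite -Rintegral_fineK// EFinM -E1 -E2.
transitivity (\int[m]_z f z)%E.
  by apply/esym; exact: (@integral_pushforward _ _ _ _ _ _ mXY P setT f).
rewrite (eq_measure_integral (m1 \x m2)%E) => [|A mA _]; last exact/esym/mE.
rewrite -integral12_prod_meas1//.
have fin2 : (\int[m2]_y y%:E)%E \is a fin_num by rewrite E2.
rewrite -(fineK fin2) -integralZr//.
apply: eq_integral => x _; rewrite fineK// -integralZl//.
Qed.

End independence.

(** * Strong law for orthogonal variables *)

Section strong_law.
Context d (T : measurableType d) (R : realType) (P : probability T R).

(** By monotone convergence the series of the W k has mean at most C, so it is finite almost surely
    and its terms vanish. *)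
Lemma ae_cvg0_summable (W : nat -> T -> R) (C : R) :
  (forall k w, 0 <= W k w) -> (forall k, integ P (W k)) ->
  (forall N, \sum_(k < N) \int[P]_w W k w <= C) ->
  {ae P, forall w, W ^~ w @ \oo --> (0 : R)}.
Proof.
move=> W0 iW WC; pose S w := (\sum_(k <oo) (W k w)%:E)%E.
have mS : measurable_fun setT S.
  apply: ge0_emeasurable_sum => [k w _ _|k _]; first by rewrite lee_fin.
  exact: (measurable_int _ (iW k)).
have S0 w : (0 <= S w)%E by apply: nneseries_ge0 => k _ _; rewrite lee_fin.
have iS : P.-integrable setT S.
  apply/integrableP; split => //.
  under eq_integral do rewrite gee0_abs//.
  rewrite integral_nneseries//; last 2 first.
  - by move=> k; exact: (measurable_int _ (iW k)).
  - by move=> k w _; rewrite lee_fin.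
  apply: (@le_lt_trans _ _ C%:E); last exact: ltry.
  apply: lime_le.
    by apply: is_cvg_nneseries => k _ _; apply: integral_ge0 => w _; rewrite lee_fin.
  near=> N; rewrite big_mkord.
  under eq_bigr do rewrite Rintegral_fineK//.
  by rewrite sumEFin lee_fin.
apply: filterS (integrable_ae measurableT iS) => w /(_ I) Sfin.
apply: cvg_series_cvg_0; apply: nondecreasing_is_cvgn.
  by apply: nondecreasing_series => k _ _.
exists (fine (S w)) => _ [N _ <-]; rewrite /series/= -lee_fin fineK// -sumEFin.
by apply: nneseries_lim_ge => k _ _; rewrite lee_fin.
Unshelve. all: by end_near. Qed.

Lemma sum_inv_sqr_le (N : nat) : \sum_(k < N) (k.+1%:R ^+ 2)^-1 <= 2 :> R.
Proof.
(* The bound is strengthened by the term 2 / (N + 1) so that the induction closes. *)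
suff : \sum_(k < N) (k.+1%:R ^+ 2)^-1 <= 2 - 2 / N.+1%:R :> R.
  by move=> /le_trans; apply; rewrite gerBl divr_ge0.
elim: N => [|N IH]; first by rewrite big_ord0 invr1; lra.
rewrite big_ord_recr /=; apply: le_trans (lerD IH (lexx _)) _.
rewrite -(natr1 N.+1); set x : R := N.+1%:R.
have x1 : 1 <= x by rewrite ler1n.
rewrite -subr_ge0 (_ : _ - _ = (x - 1) / (x ^+ 2 * (x + 1))); last first.
  by field; rewrite !gt_eqF//; lra.
by rewrite divr_ge0 ?subr_ge0// mulr_ge0 ?sqr_ge0//; lra.
Qed.

Section orthogonal.
Variables (Y : nat -> T -> R) (C : R).
Hypothesis mY : forall i, measurable_fun setT (Y i).
Hypothesis iY : forall i, integ P (fun w => Y i w ^+ 2).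
Hypothesis YC : forall i, \int[P]_w (Y i w ^+ 2) <= C.
Hypothesis YY : forall i j, i != j -> \int[P]_w (Y i w * Y j w) = 0.

Let sqr_sumE (s : seq nat) : (fun w => (\sum_(i <- s) Y i w) ^+ 2) =
  (fun w => \sum_(i <- s) \sum_(j <- s) Y i w * Y j w).
Proof.
apply/funext => w; rewrite expr2 mulr_suml; apply: eq_bigr => i _.
by rewrite mulr_sumr.
Qed.

Lemma integ_sqr_sum (s : seq nat) :
  integ P (fun w => (\sum_(i <- s) Y i w) ^+ 2).
Proof.
rewrite sqr_sumE.
by apply: integ_sum => i _; apply: integ_sum => j _; exact: integ_mul.
Qed.

Lemma Rintegral_sqr_sum_le (s : seq nat) : uniq s ->
  \int[P]_w ((\sum_(i <- s) Y i w) ^+ 2) <= (size s)%:R * C.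
Proof.
move=> us; rewrite sqr_sumE.
have iYY i j : integ P (fun w => Y i w * Y j w) by exact: integ_mul.
rewrite Rintegral_sum; last by move=> i _; exact: integ_sum.
rewrite -sum1_size natr_sum mulr_suml.
rewrite big_seq [leRHS]big_seq; apply: ler_sum => i is_; rewrite mul1r.
rewrite Rintegral_sum// (bigD1_seq i)//= big1_seq ?addr0.
  by rewrite -[leLHS]/(\int[P]_w (Y i w ^+ 2)).
by move=> j /andP[ji _]; rewrite YY// eq_sym.
Qed.

(** Orthogonality makes second moments of sums linear in the number of terms. Along squares the
    normalized sums then have summable second moments, and between consecutive squares there are few
    enough indices to sum all the squared increments. *)
Lemma strong_law_orthogonal :
  {ae P, forall w, (fun p => p%:R^-1 * \sum_(i < p) Y i w) @ \oo --> (0 : R)}.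
Proof.
pose S a b w := \sum_(i <- index_iota a b) Y i w.
have C0 : 0 <= C.
  by apply: le_trans (YC 0); apply: Rintegral_ge0 => w _; exact: sqr_ge0.
have ES a b : \int[P]_w (S a b w ^+ 2) <= (b - a)%:R * C.
  by rewrite -(size_iota a (b - a)); apply: Rintegral_sqr_sum_le; exact: iota_uniq.
have iS a b : integ P (fun w => S a b w ^+ 2) by exact: integ_sqr_sum.
(* the sums up to the squares, and the oscillation between two squares *)
pose W k w := (k.+1%:R ^+ 4)^-1 * (S 0 (k.+1 ^ 2)%N w ^+ 2 +
  \sum_(k.+1 ^ 2 <= p < k.+2 ^ 2) S (k.+1 ^ 2)%N p w ^+ 2).
have iW k : integ P (W k).
  by apply: integZ; apply: integD => //; exact: integ_sum.
have WC k : \int[P]_w W k w <= 10 * C * (k.+1%:R ^+ 2)^-1.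
  rewrite RintegralZl//; last by apply: integD => //; exact: integ_sum.
  rewrite RintegralD//; [|exact: iS|exact: integ_sum].
  rewrite Rintegral_sum//.
  (* Each of the 2k + 3 indices contributes at most (2k + 3) C, and (2k + 3)^2 <= 9 (k + 1)^2. *)
  have H : \sum_(k.+1 ^ 2 <= p < k.+2 ^ 2) \int[P]_w (S (k.+1 ^ 2)%N p w ^+ 2) <=
      (9 * k.+1%:R ^+ 2) * C.
    apply: (@le_trans _ _ (\sum_(k.+1 ^ 2 <= p < k.+2 ^ 2) (k.*2.+3)%:R * C)).
      rewrite big_nat [leRHS]big_nat; apply: ler_sum => p /andP[_ pk].
      apply: le_trans (ES _ _) _; rewrite ler_wpM2r// ler_nat.
      by move: pk; rewrite -!mulnn; lia.
    rewrite big_const_nat iter_addr_0 -[leLHS]mulr_natl mulrA ler_wpM2r//.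
    rewrite -natrX -!natrM ler_nat -!mulnn; nia.
  have x0 : k.+1%:R != 0 :> R by rewrite pnatr_eq0.
  rewrite (_ : 10 * C * _ = (k.+1%:R ^+ 4)^-1 *
      (k.+1%:R ^+ 2 * C + 9 * k.+1%:R ^+ 2 * C)).
    rewrite ler_wpM2l ?invr_ge0//; apply: lerD H.
    by have := ES 0 (k.+1 ^ 2)%N; rewrite subn0 natrX.
  by field.
have : {ae P, forall w, W ^~ w @ \oo --> (0 : R)}.
  apply: (@ae_cvg0_summable W (20 * C)) => //.
  - move=> k w; rewrite mulr_ge0 ?invr_ge0// addr_ge0 ?sqr_ge0//.
    by apply: sumr_ge0 => *; exact: sqr_ge0.
  - move=> N; apply: (@le_trans _ _ (\sum_(k < N) 10 * C * (k.+1%:R ^+ 2)^-1)).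
      exact: ler_sum.
    rewrite -mulr_sumr (_ : 20 * C = 10 * C * 2); last by ring.
    by rewrite ler_wpM2l ?mulr_ge0// sum_inv_sqr_le.
apply: filterS => w W0; apply: cvg_sqr0.
(* The predecessor matches [W k], whose block starts at (k + 1)^2; p = 0 lies in no block. *)
pose kk p := (PeanoNat.Nat.sqrt p).-1.
have kkP p : (0 < p)%N -> ((kk p).+1 ^ 2 <= p < (kk p).+2 ^ 2)%N.
  rewrite /kk -!mulnn => p0.
  have [] := PeanoNat.Nat.sqrt_spec p (PeanoNat.Nat.le_0_l p).
  case: (PeanoNat.Nat.sqrt p) => [|k] /= /ssrnat.leP k1 /ssrnat.ltP k2; last first.
    by rewrite k1.
  by move: k2; lia.
have kkoo : kk @ \oo --> \oo.
  apply/cvgnyPge => K; near=> p.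
  have p0 : (0 < p)%N by near: p; exact: nbhs_infty_gt.
  have pK : (K.+2 ^ 2 < p)%N by near: p; exact: nbhs_infty_gt.
  have /andP[_ pk] := kkP p p0.
  by have := ltn_trans pK pk; rewrite ltn_exp2r// => /ltnW; rewrite !ltnS.
have Wkk : (fun p => 2 * W (kk p) w) @ \oo --> (0 : R).
  by rewrite -(mulr0 2); apply: cvgMr; exact: (cvg_comp _ _ kkoo W0).
apply: (@squeeze_cvgr _ _ _ _ (fun=> 0) (fun p => 2 * W (kk p) w)) => //.
  near=> p; have p0 : (0 < p)%N by near: p; exact: nbhs_infty_gt.
  rewrite sqr_ge0 /=; set k := kk p.
  have /andP[kp pk] := kkP p p0; rewrite -/k in kp pk.
  have -> : \sum_(i < p) Y i w = S 0 (k.+1 ^ 2)%N w + S (k.+1 ^ 2)%N p w.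
    by rewrite /S -big_cat_nat// big_mkord.
  have H1 : S (k.+1 ^ 2)%N p w ^+ 2 <=
      \sum_(k.+1 ^ 2 <= p < k.+2 ^ 2) S (k.+1 ^ 2)%N p w ^+ 2.
    rewrite (bigD1_seq p) ?iota_uniq ?mem_index_iota ?kp//= lerDl.
    by apply: sumr_ge0 => *; exact: sqr_ge0.
  set a := S 0 _ w in H1 *; set b := S _ p w in H1 *.
  rewrite exprMn exprVn /W -/a.
  apply: (@le_trans _ _ ((k.+1%:R ^+ 4)^-1 * (a + b) ^+ 2)).
    rewrite ler_wpM2r ?sqr_ge0// lef_pV2 ?posrE ?exprn_gt0 ?ltr0n//.
    by rewrite -!natrX ler_nat (_ : 4 = 2 * 2)%N// expnM leq_exp2r.
  rewrite [leRHS]mulrCA ler_wpM2l ?invr_ge0//.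
  by have := sqr_ge0 (a - b); lra.
exact: cvg_cst.
Unshelve. all: by end_near. Qed.

End orthogonal.

End strong_law.

(** * Fourth moments of sums *)

Section fourth_moments.
Context d (T : measurableType d) (R : realType) (P : probability T R).

Lemma integ_expr (X : T -> R) (k : nat) : (k <= 4)%N -> measurable_fun setT X ->
  integ P (fun w => X w ^+ 4) -> integ P (fun w => X w ^+ k).
Proof.
move=> k4 mX iX; apply: (@integ_dominated _ _ _ P _ (fun w => 1 + X w ^+ 4)).
- exact: measurable_funX.
- move=> w; rewrite normrX.
  have -> : X w ^+ 4 = `|X w| ^+ 4 by rewrite -normrX ger0_norm// exprn_even_ge0.
  have [x1|x1] := leP `|X w| 1.
    by rewrite (@le_trans _ _ 1) ?exprn_ile1// lerDl exprn_ge0.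
  by rewrite (@le_trans _ _ (`|X w| ^+ 4)) ?ler_weXn2l ?lerDr// ltW.
- by apply: integD => //; exact: integ_cst.
Qed.

Lemma integ_expr4D (X Y : T -> R) : measurable_fun setT X -> measurable_fun setT Y ->
  integ P (fun w => X w ^+ 4) -> integ P (fun w => Y w ^+ 4) ->
  integ P (fun w => (X w + Y w) ^+ 4).
Proof.
move=> mX mY iX iY.
apply: (@integ_dominated _ _ _ P _ (fun w => 8 * X w ^+ 4 + 8 * Y w ^+ 4)).
- by apply: measurable_funX; exact: measurable_funD.
- move=> w /=; rewrite ger0_norm ?exprn_even_ge0//.
  set x := X w; set y := Y w.
  have H1 : (x + y) ^+ 2 <= 2 * x ^+ 2 + 2 * y ^+ 2.
    by have := sqr_ge0 (x - y); lra.
  have H2 : ((x + y) ^+ 2) ^+ 2 <= (2 * x ^+ 2 + 2 * y ^+ 2) ^+ 2.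
    by rewrite ler_sqr ?nnegrE ?sqr_ge0// addr_ge0// mulr_ge0// sqr_ge0.
  rewrite -(exprM _ 2 2) in H2; apply: le_trans H2 _.
  rewrite -subr_ge0 (_ : _ - _ = 4 * (x ^+ 2 - y ^+ 2) ^+ 2); last by ring.
  by rewrite mulr_ge0// sqr_ge0.
- by apply: integD; exact: integZ.
Qed.

Lemma integ_indep_comp (X Y : T -> R) (f g : R -> R) :
  measurable_fun setT f -> measurable_fun setT g ->
  (forall A B, measurable A -> measurable B ->
    (P (X @^-1` A `&` Y @^-1` B) = P (X @^-1` A) * P (Y @^-1` B))%E) ->
  integ P (f \o X) -> integ P (g \o Y) ->
  integ P (fun w => f (X w) * g (Y w)) /\
  \int[P]_w (f (X w) * g (Y w)) = (\int[P]_w f (X w)) * (\int[P]_w g (Y w)).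
Proof.
move=> mf mg XY ifX igY; apply: integ_indep => // A B mA mB.
apply: (XY (f @^-1` A) (g @^-1` B)); rewrite -[V in measurable V]setTI.
  exact: mf.
exact: mg.
Qed.

(** T is equipped with the sigma-algebra of the group, so that closure of measurable functions under
    sums yields measurability with respect to it. *)
Lemma measurable_group (I : choiceType) (F : I -> set (set T)) (D : set I)
    (U : I -> T -> R) (s : seq I) :
  (forall i A, measurable A -> F i (U i @^-1` A)) -> (forall i, i \in s -> D i) ->
  forall A, measurable A ->
  group_sigma D F ((fun w => \sum_(i <- s) U i w) @^-1` A).
Proof.
move=> FU sD A mA.
have : measurable_fun setT (fun w : g_sigma_algebraType (\bigcup_(i in D) F i) =>
    \sum_(i <- s) U i w).
  elim: s sD => [_|i s IH sD].
    rewrite [X in measurable_fun _ X](_ : _ = cst 0); first exact: measurable_cst.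
    by apply/funext => w; rewrite big_nil.
  rewrite [X in measurable_fun _ X](_ : _ =
      U i \+ (fun w => \sum_(k <- s) U k w)); last first.
    by apply/funext => w; rewrite big_cons.
  apply: measurable_funD; last by apply: IH => k ks; apply: sD; rewrite inE ks orbT.
  move=> _ B mB; rewrite setTI; apply: sub_sigma_algebra.
  by exists i; [apply: sD; rewrite mem_head|exact: FU].
by move=> /(_ measurableT A mA); rewrite setTI.
Qed.

Section fourth_moment_sum.
Context (F : nat -> set (set T)) (U : nat -> T -> R) (K : R).
Hypothesis sF : forall i, sigma_algebra setT (F i).
Hypothesis Fm : forall i, F i `<=` measurable.
Hypothesis iF : mutual_indep P F.
Hypothesis FU : forall i A, measurable A -> F i (U i @^-1` A).
Hypothesis iU : forall i, integ P (fun w => U i w ^+ 4).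
Hypothesis U0 : forall i, \int[P]_w U i w = 0.
Hypothesis U2 : forall i, \int[P]_w (U i w ^+ 2) <= K.
Hypothesis U4 : forall i, \int[P]_w (U i w ^+ 4) <= K.
Hypothesis K1 : 1 <= K.

Let mU i : measurable_fun setT (U i).
Proof. by move=> _ A mA; rewrite setTI; exact/(@Fm i)/FU. Qed.

Let mS s : measurable_fun setT (fun w => \sum_(i <- s) U i w).
Proof. exact: measurable_sum. Qed.

Lemma integ_sum4 (s : seq nat) : integ P (fun w => (\sum_(i <- s) U i w) ^+ 4).
Proof.
elim: s => [|i s IH].
  rewrite [X in integ _ X](_ : _ = cst 0); first exact: integ_cst.
  by apply/funext => w; rewrite big_nil expr0n.
rewrite [X in integ _ X](_ : _ = fun w => (U i w + \sum_(k <- s) U k w) ^+ 4).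
  exact: integ_expr4D.
by apply/funext => w; rewrite big_cons.
Qed.

Let indepS i s : i \notin s -> forall A B, measurable A -> measurable B ->
  (P ((fun w => \sum_(k <- s) U k w)%R @^-1` A `&` U i @^-1` B) =
   P ((fun w => \sum_(k <- s) U k w)%R @^-1` A) * P (U i @^-1` B))%E.
Proof.
move=> is_ A B mA mB.
apply: (@indep_group _ _ _ P _ F [set k | k \in s] i) => //.
- exact/negP.
- exact: measurable_group.
- exact: FU.
Qed.

Lemma indep_power_moments (s : seq nat) i a b :
  i \notin s -> (a <= 4)%N -> (b <= 4)%N ->
  integ P (fun w => (\sum_(k <- s) U k w) ^+ a * U i w ^+ b) /\
  \int[P]_w ((\sum_(k <- s) U k w) ^+ a * U i w ^+ b) =
  \int[P]_w ((\sum_(k <- s) U k w) ^+ a) * \int[P]_w (U i w ^+ b).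
Proof.
move=> is_ a4 b4.
apply: (@integ_indep_comp _ _ (fun x => x ^+ a) (fun x => x ^+ b)).
- by apply: measurable_funX; exact: measurable_id.
- by apply: measurable_funX; exact: measurable_id.
- exact: indepS.
- by apply: integ_expr => //; exact: integ_sum4.
- exact: integ_expr.
Qed.

Lemma Rintegral_sum0 s : \int[P]_w (\sum_(i <- s) U i w) = 0.
Proof.
rewrite Rintegral_sum ?big1// => i _.
exact: (@integ_expr (U i) 1).
Qed.

Lemma Rintegral_sum2_le (s : seq nat) : uniq s ->
  \int[P]_w ((\sum_(i <- s) U i w) ^+ 2) <= (size s)%:R * K.
Proof.
apply: Rintegral_sqr_sum_le => // [i|i j ij].
  exact: integ_expr.
have : i \notin [:: j] by rewrite inE.
move=> /indep_power_moments - /(_ 1%N 1%N isT isT) [_].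
under eq_Rintegral => w _ do rewrite big_seq1 !expr1 mulrC.
move=> ->; under [X in _ * X = _]eq_Rintegral do rewrite expr1.
by rewrite U0 mulr0.
Qed.

(** Adding a variable U to a sum S of m others, the terms in S^3 U and S U^3 vanish in mean, leaving
    E S^4 + 6 E S^2 E U^2 + E U^4. This is at most 3 K^2 m^2 + 6 K^2 m + K, below 3 K^2 (m + 1)^2
    because K <= K^2. *)
Lemma Rintegral_sum4_le (s : seq nat) : uniq s ->
  \int[P]_w ((\sum_(i <- s) U i w) ^+ 4) <= 3 * K ^+ 2 * (size s)%:R ^+ 2.
Proof.
elim: s => [_|i s IH /= /andP[is_ us]].
  under eq_Rintegral do rewrite big_nil expr0n.
  by rewrite Rintegral_cst// mul0r expr0n mulr0.
pose S w := \sum_(k <- s) U k w.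
have M a b : (a <= 4)%N -> (b <= 4)%N -> integ P (fun w => S w ^+ a * U i w ^+ b) /\
    \int[P]_w (S w ^+ a * U i w ^+ b) = \int[P]_w (S w ^+ a) * \int[P]_w (U i w ^+ b).
  exact: indep_power_moments.
have ES : \int[P]_w S w = 0 by exact: Rintegral_sum0.
have ES2 : \int[P]_w (S w ^+ 2) <= (size s)%:R * K by exact: Rintegral_sum2_le.
have ES4 : \int[P]_w (S w ^+ 4) <= 3 * K ^+ 2 * (size s)%:R ^+ 2 by exact: IH.
(* Exponents 0 and 1 stay explicit so that the product rule [M] applies to all five terms. *)
have -> : (fun w => (\sum_(k <- i :: s) U k w) ^+ 4) = (fun w =>
    (S w ^+ 4 * U i w ^+ 0 + 4 * (S w ^+ 3 * U i w ^+ 1)) +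
    ((6 * (S w ^+ 2 * U i w ^+ 2) + 4 * (S w ^+ 1 * U i w ^+ 3)) +
     S w ^+ 0 * U i w ^+ 4)).
  by apply/funext => w; rewrite big_cons -/(S w); ring.
have [i40 e40] := M 4%N 0%N isT isT; have [i31 e31] := M 3%N 1%N isT isT.
have [i22 e22] := M 2%N 2%N isT isT; have [i13 e13] := M 1%N 3%N isT isT.
have [i04 e04] := M 0%N 4%N isT isT.
have I31 := integZ 4 i31; have I22 := integZ 6 i22; have I13 := integZ 4 i13.
have I1 := integD i40 I31; have I2 := integD I22 I13; have I3 := integD I2 i04.
rewrite (RintegralD measurableT I1 I3) (RintegralD measurableT i40 I31).
rewrite (RintegralD measurableT I2 i04) (RintegralD measurableT I22 I13).
cbv beta; rewrite e40 e04 !RintegralZl//; cbv beta; rewrite e31 e22 e13.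
have p1 (X : T -> R) : \int[P]_w (X w ^+ 1) = \int[P]_w X w by [].
have p0 (X : T -> R) : \int[P]_w (X w ^+ 0) = 1.
  under eq_Rintegral do rewrite expr0; rewrite Rintegral_cst// mul1r.
  exact: (congr1 fine (probability_setT P)).
rewrite !p1 !p0 U0 ES !(mulr0, mul0r, mulr1, mul1r, addr0).
move: ES4 ES2 (U2 i) (U4 i).
set u4 := \int[P]_w (U i w ^+ 4); set u2 := \int[P]_w (U i w ^+ 2).
set s2 := \int[P]_w (S w ^+ 2); set s4 := \int[P]_w (S w ^+ 4).
move=> s4K s2K u2K u4K; rewrite -[(size s).+1]addn1 natrD.
have u20 : 0 <= u2 by apply: Rintegral_ge0 => w _; exact: sqr_ge0.
have s20 : 0 <= s2 by apply: Rintegral_ge0 => w _; exact: sqr_ge0.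
have := ler_pM s20 u20 s2K u2K.
have : K <= K ^+ 2 by rewrite expr2 ler_peMl//; lra.
set m : R := (size s)%:R; lra.
Qed.

End fourth_moment_sum.

End fourth_moments.

(** * Projection on a random partition *)

Section random_partition.
Context d (T : measurableType d) (R : realType) (P : probability T R).
Context (F : nat -> set (set T)) (U : nat -> T -> R) (K : R).
Hypothesis sF : forall i, sigma_algebra setT (F i).
Hypothesis Fm : forall i, F i `<=` measurable.
Hypothesis iF : mutual_indep P F.
Hypothesis FU : forall i A, measurable A -> F i (U i @^-1` A).
Hypothesis iU : forall i, integ P (fun w => U i w ^+ 4).
Hypothesis U0 : forall i, \int[P]_w U i w = 0.
Hypothesis U2 : forall i, \int[P]_w (U i w ^+ 2) <= K.
Hypothesis U4 : forall i, \int[P]_w (U i w ^+ 4) <= K.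
Hypothesis K1 : 1 <= K.

Let block p (A : {set {set 'I_p}}) w : R :=
  p%:R^-1 * blockdot A (\col_i U i w) (\col_i U i w).

(** Atoms become lists of naturals, the index type of the moment bounds. *)
Let indices p (I : {set 'I_p}) : seq nat := [seq val i | i <- enum I].

Let X p (I : {set 'I_p}) w : R :=
  (\sum_(k <- indices I) U k w) ^+ 2 / #|I|%:R.

Let blockE p (A : {set {set 'I_p}}) w :
  block A w = p%:R^-1 * \sum_(I <- enum A) X I w.
Proof.
rewrite /block /blockdot big_enum /=; congr (_ * _); apply: eq_bigr => I _.
rewrite /X /indices big_map big_enum/= expr2.
by congr (_ * _ / _); apply: eq_bigr => i _; rewrite mxE.
Qed.

Let measurable_block p (A : {set {set 'I_p}}) B : measurable B ->
  group_sigma setT F (block A @^-1` B).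
Proof.
move=> mB.
have : measurable_fun setT
    (block A : g_sigma_algebraType (\bigcup_(i in setT) F i) -> R).
  have -> : block A = fun w => p%:R^-1 * \sum_(I <- enum A) X I w.
    by apply/funext => w; exact: blockE.
  apply: measurable_funM; first exact: measurable_cst.
  apply: measurable_sum => I; apply: measurable_funM; last exact: measurable_cst.
  apply: measurable_funX; apply: measurable_sum => i _ C mC.
  by rewrite setTI; apply: sub_sigma_algebra; exists i => //; exact: FU.
by move=> /(_ measurableT B mB); rewrite setTI.
Qed.

Let mX p (I : {set 'I_p}) : measurable_fun setT (X I).
Proof.
apply: measurable_funM; last exact: measurable_cst.
apply: measurable_funX; apply: measurable_sum => i _ C mC.
by rewrite setTI; exact/(@Fm i)/FU.
Qed.

Let X2E p (I : {set 'I_p}) : (fun w => X I w ^+ 2) =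
  (fun w => (#|I|%:R ^+ 2)^-1 * (\sum_(k <- indices I) U k w) ^+ 4).
Proof.
by apply/funext => w; rewrite /X exprMn exprVn -(exprM _ 2 2) mulrC.
Qed.

Let iX2 p (I : {set 'I_p}) : integ P (fun w => X I w ^+ 2).
Proof. by rewrite X2E; apply: integZ; exact: (integ_sum4 Fm FU iU). Qed.

(** The factor |I|^2 of the fourth moment bound cancels the normalization, so the bound is uniform
    over atoms. For empty I the convention that 0 has inverse 0 applies. *)
Let EX2 p (I : {set 'I_p}) : \int[P]_w (X I w ^+ 2) <= 3 * K ^+ 2.
Proof.
rewrite X2E RintegralZl//; last exact: (integ_sum4 Fm FU iU).
have uI : uniq (indices I) by rewrite map_inj_uniq ?enum_uniq//; exact: val_inj.
have := Rintegral_sum4_le sF Fm iF FU iU U0 U2 U4 K1 uI.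
rewrite size_map -cardE => H.
have [->|I0] := eqVneq #|I| 0%N.
  by rewrite expr0n invr0 mul0r mulr_ge0 ?sqr_ge0.
rewrite mulrC ler_pdivrMr// exprn_gt0// ltr0n lt0n//.
Qed.

Let block2E p (A : {set {set 'I_p}}) : (fun w => block A w ^+ 2) =
  (fun w => (p%:R ^+ 2)^-1 * \sum_(I <- enum A) \sum_(J <- enum A) X I w * X J w).
Proof.
apply/funext => w; rewrite blockE exprMn exprVn; congr (_ * _).
by rewrite expr2 mulr_suml; apply: eq_bigr => I _; rewrite mulr_sumr.
Qed.

Lemma integ_block_sqr p (A : {set {set 'I_p}}) : integ P (fun w => block A w ^+ 2).
Proof.
rewrite block2E.
by apply: integZ; do 2 (apply: integ_sum => ? _); exact: integ_mul.
Qed.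

(** Expanding the square gives |A|^2 products X_I X_J, each at most half the sum of the two squares,
    whose means are bounded by [EX2]. *)
Lemma Rintegral_block_sqr_le p (A : {set {set 'I_p}}) :
  \int[P]_w (block A w ^+ 2) <= 3 * K ^+ 2 * (#|A|%:R / p%:R) ^+ 2.
Proof.
rewrite block2E.
have iXX (I J : {set 'I_p}) : integ P (fun w => X I w * X J w) by exact: integ_mul.
rewrite RintegralZl//; last by do 2 (apply: integ_sum => ? _).
rewrite Rintegral_sum; last by move=> I _; exact: integ_sum.
rewrite exprMn exprVn mulrA mulrC ler_wpM2r ?invr_ge0//.
apply: (@le_trans _ _ (\sum_(I <- enum A) \sum_(J <- enum A) 3 * K ^+ 2)); last first.
  rewrite !big_const_seq !iter_addr_0 !count_predT -cardE -mulrnA.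
  by rewrite -[leLHS]mulr_natr natrM -expr2.
apply: ler_sum => I _; rewrite Rintegral_sum//; apply: ler_sum => J _.
have iD : integ P (fun w => 2^-1 * X I w ^+ 2 + 2^-1 * X J w ^+ 2).
  by apply: integD; exact: integZ.
apply: (@le_trans _ _ (\int[P]_w (2^-1 * X I w ^+ 2 + 2^-1 * X J w ^+ 2))).
  apply: (le_Rintegral measurableT (iXX I J) iD) => w _.
  by have := sqr_ge0 (X I w - X J w); lra.
rewrite RintegralD//; [|exact: integZ|exact: integZ].
rewrite !RintegralZl//; [|exact: iX2|exact: iX2].
by have := EX2 I; have := EX2 J; lra.
Qed.

Variable g : set (set T).
Hypothesis gm : <<s g>> `<=` measurable.
Hypothesis gF : indep_sets P <<s g>> (group_sigma setT F).
Variable Q : forall p : nat, T -> {set {set 'I_p}}.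
Hypothesis gQ : forall p A, <<s g>> [set w | Q p w = A].

Let a p w : R := (#|Q p w|%:R / p%:R) ^+ 2.

Let Rintegral_indic_mul B (V : T -> R) : <<s g>> B ->
  (forall C, measurable C -> group_sigma setT F (V @^-1` C)) -> integ P V ->
  integ P (fun w => \1_B w * V w) /\
  \int[P]_w (\1_B w * V w) = (\int[P]_w \1_B w) * \int[P]_w V w.
Proof.
move=> gB FV iV.
have i1 : integ P (\1_B : T -> R) by apply: integrable_indic; exact: gm.
have m1 : measurable_fun setT (\1_B : g_sigma_algebraType g -> R).
  exact: measurable_indic.
apply: integ_indep => // C D mC mD; apply: gF; last exact: FV.
by have := m1 measurableT C mC; rewrite setTI.
Qed.

Let gfin p (f : {set {set 'I_p}} -> R) :
  measurable_fun setT ((fun w => f (Q p w)) : g_sigma_algebraType g -> R).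
Proof.
move=> _ B mB; rewrite setTI.
have -> : (fun w => f (Q p w)) @^-1` B =
    \bigcup_(A in [set A | B (f A)]) [set w | Q p w = A].
  apply/seteqP; split => [w Bw|w [A BA QA]]; first by exists (Q p w).
  by rewrite /= QA.
apply: (@fin_bigcup_measurable _ (g_sigma_algebraType g)).
  exact: finite_finset.
by move=> A _; exact: gQ.
Qed.

(** A truncation determined by the partitions up to p, in the manner of a stopping time: the series
    of (k_q / q)^2 is random and may have no deterministic bound. The sum includes the index p
    itself, as [sum_good_le] requires. *)
Let good (N : nat) p : set T := [set w | \sum_(q < p.+1) a q w <= N%:R].

Let ggood N p : <<s g>> (good N p).
Proof.
have : measurable_fun setT
    ((fun w => \sum_(q < p.+1) a q w) : g_sigma_algebraType g -> R).
  apply: measurable_sum => q.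
  exact: (@gfin q (fun A => (#|A|%:R / q%:R) ^+ 2)).
move=> /(_ measurableT `]-oo, N%:R]%classic); rewrite setTI.
move=> /(_ (measurable_itv _)); congr (<<s g>> _).
Qed.

Let W N p w : R := \1_(good N p) w * block (Q p w) w ^+ 2.

(** [Q p] has finitely many values; on the event that it equals A, the random partition is replaced
    by the fixed A, whose block is independent of that event. *)
Let decomp N p (f : {set {set 'I_p}} -> R) w : \1_(good N p) w * f (Q p w) =
  \sum_(A : {set {set 'I_p}}) \1_(good N p `&` [set w | Q p w = A]) w * f A.
Proof.
rewrite (bigD1 (Q p w))//= [X in _ + X]big1 ?addr0.
  by congr (_ * _); rewrite !indicE in_setI [X in _ && X]mem_set ?andbT.
move=> A AQ; rewrite indicE in_setI [X in _ && X]memNset ?andbF ?mul0r//=.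
by move=> QA; rewrite QA eqxx in AQ.
Qed.

Let WE N p : W N p = fun w => \sum_(A : {set {set 'I_p}})
  \1_(good N p `&` [set w | Q p w = A]) w * block A w ^+ 2.
Proof. by apply/funext => w; exact: (decomp N (fun A => block A w ^+ 2)). Qed.

Let gI B C : <<s g>> B -> <<s g>> C -> <<s g>> (B `&` C).
Proof. exact: (@measurableI _ (g_sigma_algebraType g)). Qed.

Let mblock2 p (A : {set {set 'I_p}}) C : measurable C ->
  group_sigma setT F ((fun w => block A w ^+ 2) @^-1` C).
Proof.
move=> mC; apply: (measurable_block A (B := (fun x : R => x ^+ 2) @^-1` C)).
rewrite -[V in measurable V]setTI.
by apply: measurable_funX => //; exact: measurable_id.
Qed.

Let indic_block N p (A : {set {set 'I_p}}) :
  let I := \1_(good N p `&` [set w | Q p w = A]) in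
  integ P (fun w => I w * block A w ^+ 2) /\
  \int[P]_w (I w * block A w ^+ 2) = (\int[P]_w I w) * \int[P]_w (block A w ^+ 2).
Proof.
apply: Rintegral_indic_mul; last exact: integ_block_sqr.
- by apply: gI; [exact: ggood|exact: gQ].
- by move=> C; exact: mblock2.
Qed.

Let iW N p : integ P (W N p).
Proof.
rewrite WE; apply: integ_sum => A _.
by have [] := indic_block N A.
Qed.

Let ind N p (A : {set {set 'I_p}}) w : R := \1_(good N p `&` [set w | Q p w = A]) w.

Let iind N p A : integ P (@ind N p A).
Proof. by apply: integrable_indic; apply: gm; apply: gI; [exact: ggood|exact: gQ]. Qed.

Let aE N p : (fun w => \1_(good N p) w * a p w) =
  (fun w => \sum_(A : {set {set 'I_p}}) (#|A|%:R / p%:R) ^+ 2 * ind N A w).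
Proof.
apply/funext => w; rewrite (decomp N (fun A => (#|A|%:R / p%:R) ^+ 2)).
by apply: eq_bigr => A _; rewrite mulrC.
Qed.

Let ia N p : integ P (fun w => \1_(good N p) w * a p w).
Proof. by rewrite aE; apply: integ_sum => A _; exact: integZ. Qed.

Let EW N p : \int[P]_w W N p w <= 3 * K ^+ 2 * \int[P]_w (\1_(good N p) w * a p w).
Proof.
have iB A := (indic_block N A).1.
rewrite WE aE Rintegral_sum; last by move=> A _; exact: iB.
rewrite Rintegral_sum; last by move=> A _; exact: integZ.
rewrite mulr_sumr; apply: ler_sum => A _.
rewrite (indic_block N A).2.
rewrite RintegralZl//; last exact: iind.
rewrite mulrA [leRHS]mulrC ler_wpM2l ?Rintegral_block_sqr_le//.
by apply: Rintegral_ge0 => w _; rewrite indicE.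
Qed.

(** If n is good, the untruncated sum through n is at most N; otherwise the last term is 0 and the
    induction hypothesis applies. *)
Let sum_good_le N n w : \sum_(p < n) \1_(good N p) w * a p w <= N%:R.
Proof.
elim: n => [|n IH]; first by rewrite big_ord0.
have [wn|wn] := pselect (good N n w).
  apply: le_trans wn; apply: ler_sum => q _.
  by rewrite ler_piMl ?sqr_ge0// indicE; case: (_ \in _).
by rewrite big_ord_recr/= [X in _ + X * _]indicE memNset// mul0r addr0.
Qed.

(** The means of the [W N p] sum to at most 3 K^2 N, so [W N p] vanishes almost surely,
    simultaneously for the countably many integers N. When the series is bounded, some N makes every
    index good, and [W N p] is then the squared block. *)
Lemma ae_block_cvg0 : {ae P, forall w,
  (exists N : R, forall p, \sum_(q < p) (#|Q q w|%:R / q%:R) ^+ 2 <= N) ->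
  (fun p => p%:R^-1 * blockdot (Q p w) (\col_i U i w) (\col_i U i w))
    @ \oo --> (0 : R)}.
Proof.
have H : {ae P, forall w, forall N, W N ^~ w @ \oo --> (0 : R)}.
  apply: ae_foralln => N.
  apply: (@ae_cvg0_summable _ _ _ P (W N) (3 * K ^+ 2 * N%:R)) => //.
    by move=> k w; rewrite mulr_ge0 ?sqr_ge0.
  move=> n; apply: (@le_trans _ _ (\sum_(k < n) 3 * K ^+ 2 *
      \int[P]_w (\1_(good N k) w * a k w))); first exact: ler_sum.
  rewrite -mulr_sumr; apply: ler_wpM2l; first by rewrite mulr_ge0// sqr_ge0.
  rewrite -Rintegral_sum; last by move=> k _; exact: ia.
  apply: (@le_trans _ _ (\int[P]_w (N%:R))).
    apply: (le_Rintegral measurableT _ (integ_cst P N%:R)) => [|w _].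
      by apply: integ_sum => k _; exact: ia.
    exact: sum_good_le.
  by rewrite Rintegral_cst// (congr1 fine (probability_setT P)) mulr1.
apply: filterS H => w H [N HN]; apply: cvg_sqr0.
pose M := (Num.truncn N).+1.
have NM : N <= M%:R by exact/ltW/truncnS_gt.
apply: (cvg_trans _ (H M)); apply: near_eq_cvg; near=> p.
rewrite /W indicE mem_set ?mul1r//.
by apply: le_trans (HN p.+1) NM.
Unshelve. all: by end_near. Qed.

End random_partition.

(** * The factor model *)

Section generated_sigma_algebra.
Context d (T : measurableType d) (R : realType).

(** The generators of [sigma_rv X]: with [g_sigma_algebraType] they turn T into a space on which
    measurability means measurability with respect to [sigma_rv X]. *)
Definition rv_preimages (I : Type) (X : I -> T -> R) : set (set T) :=
  \bigcup_i preimage_set_system setT (X i) measurable.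

Lemma sigma_rv_measurable (I : Type) (X : I -> T -> R) i :
  measurable_fun setT (X i : g_sigma_algebraType (rv_preimages X) -> R).
Proof.
by move=> _ A mA; apply: sub_sigma_algebra; exists i => //; exists A.
Qed.

Lemma sigma_rv_preimage (I : Type) (X : I -> T -> R) (f : T -> R) A :
  measurable_fun setT (f : g_sigma_algebraType (rv_preimages X) -> R) ->
  measurable A -> sigma_rv X (f @^-1` A).
Proof. by move=> mf mA; have := mf measurableT A mA; rewrite setTI. Qed.

Lemma sub_sigma_rv (I : Type) (X : I -> T -> R) :
  (forall i, measurable_fun setT (X i)) -> sigma_rv X `<=` measurable.
Proof.
move=> mX; apply: smallest_sub; first exact: sigma_algebra_measurable.
by move=> _ [i _ [A mA <-]]; exact: mX.
Qed.

Lemma sigma_rv_algebra (I : Type) (X : I -> T -> R) : sigma_algebra setT (sigma_rv X).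
Proof. exact: smallest_sigma_algebra. Qed.

Variable P : probability T R.

Lemma mutual_indep_pair (I : eqType) (F : I -> set (set T)) (i j : I) :
  (forall k, sigma_algebra setT (F k)) -> mutual_indep P F -> i != j ->
  indep_sets P (F i) (F j).
Proof.
move=> sF iF ij A B FA FB.
pose E k := if k == i then A else if k == j then B else setT.
have FE k : F k (E k).
  rewrite /E; case: eqP => [->//|_]; case: eqP => [->//|_].
  by have [F0 FC _] := sF k; rewrite -(setD0 setT); exact: FC.
have := iF [:: i; j] E; rewrite /= inE ij => /(_ isT (fun k _ => FE k)).
rewrite !big_cons big_nil mule1 {2 3}/E eqxx eq_sym (negPf ij) eqxx => <-.
congr (P _); apply/seteqP; split => [w [Aw Bw] k /=|w Ew].
  rewrite !inE /E => /orP[/eqP ->|/eqP ->]; first by rewrite eqxx.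
  by rewrite eq_sym (negPf ij) eqxx.
split; first by have := Ew i; rewrite /= mem_head /E eqxx => /(_ isT).
by have := Ew j; rewrite /= !inE eqxx orbT /E eq_sym (negPf ij) eqxx => /(_ isT).
Qed.

Lemma integ_indep_sigma_rv (I J : Type) (X : I -> T -> R) (Y : J -> T -> R)
    (U V : T -> R) :
  indep_sets P (sigma_rv X) (sigma_rv Y) ->
  measurable_fun setT (U : g_sigma_algebraType (rv_preimages X) -> R) ->
  measurable_fun setT (V : g_sigma_algebraType (rv_preimages Y) -> R) ->
  integ P U -> integ P V ->
  integ P (fun w => U w * V w) /\
  \int[P]_w (U w * V w) = (\int[P]_w U w) * \int[P]_w V w.
Proof.
move=> XY mU mV; apply: integ_indep => A B mA mB.
by apply: XY; exact: sigma_rv_preimage.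
Qed.

End generated_sigma_algebra.

(** * Moments and strong laws of the noise *)

Section noise.
Context (R : realType) d (T : measurableType d) (P : probability T R) (n : nat)
  (Z : nat -> 'I_n -> {RV P >-> R}) (delta : R).
Hypothesis hA4 : A4 Z delta.

Let z i j : T -> R := Z i j.

Let mz i j : measurable_fun setT (z i j). Proof. exact: measurable_funP. Qed.

Lemma noise_integ4 i j : integ P (fun w => z i j w ^+ 4).
Proof.
have [_ _ [C HC] _ _] := hA4.
apply/integrableP; split; first by apply/measurable_EFinP; exact: measurable_funX.
apply: (@le_lt_trans _ _ C%:E); last exact: ltry.
have := HC i j; rewrite unlock; congr (_ <= _)%E; apply: eq_integral => w _ /=.
by rewrite ger0_norm// exprn_even_ge0.
Qed.

Lemma noise_integX i j k : (k <= 4)%N -> integ P (fun w => z i j w ^+ k).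
Proof. by move=> k4; apply: integ_expr => //; exact: noise_integ4. Qed.

Lemma noise_integ i j : integ P (z i j).
Proof. exact: (@noise_integX i j 1). Qed.

Lemma noise_mean i j : \int[P]_w z i j w = 0.
Proof.
have [_ /(_ i j)[Z0 _] _ _ _] := hA4.
by move: Z0; rewrite unlock /Rintegral => ->.
Qed.

Lemma noise_integM i j k : integ P (fun w => z i j w * z i k w).
Proof. by apply: integ_mul => //; exact: noise_integX. Qed.

Lemma noise_cov i j k : \int[P]_w (z i j w * z i k w) = delta ^+ 2 * (j == k)%:R.
Proof.
have [_ Z2 _ _ Zcov] := hA4; have [Zj ZV] := Z2 i j; have [Zk _] := Z2 i k.
have cE : covariance P (Z i j) (Z i k) = (delta ^+ 2 * (j == k)%:R)%:E.
  have [<-|jk] := eqVneq j k; first by rewrite mulr1 -ZV.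
  by rewrite mulr0 Zcov.
move: cE; rewrite covariance.unlock Zj Zk /= expectation.unlock => cE.
apply: EFin_inj; rewrite -Rintegral_fineK; last exact: noise_integM.
rewrite -cE.
apply: eq_integral => w _; congr (_%:E).
by rewrite -[RHS]/((z i j w - 0) * (z i k w - 0)) !subr0.
Qed.

Lemma noise_moments_bound : exists2 K : R, 1 <= K &
  forall i j, \int[P]_w (z i j w ^+ 2) <= K /\ \int[P]_w (z i j w ^+ 4) <= K.
Proof.
have [_ _ [C HC] _ _] := hA4.
exists (1 + delta ^+ 2 + `|C|); first by rewrite -addrA lerDl addr_ge0 ?sqr_ge0.
move=> i j; split.
  have := noise_cov i j j; rewrite eqxx mulr1 /= => ->.
  by have := normr_ge0 C; lra.
rewrite -lee_fin -Rintegral_fineK; last exact: noise_integ4.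
have := HC i j; rewrite unlock => /le_trans; apply; rewrite lee_fin.
by have := ler_norm C; have := sqr_ge0 delta; lra.
Qed.

Lemma noise_rows_indep (U V : T -> R) i k : i != k ->
  measurable_fun setT (U : g_sigma_algebraType (rv_preimages (Z i)) -> R) ->
  measurable_fun setT (V : g_sigma_algebraType (rv_preimages (Z k)) -> R) ->
  integ P U -> integ P V ->
  \int[P]_w (U w * V w) = (\int[P]_w U w) * \int[P]_w V w.
Proof.
move=> ik mU mV iU iV; have [_ _ _ iZ _] := hA4.
have ZZ := mutual_indep_pair (fun k => @sigma_rv_algebra _ _ _ _ (Z k)) iZ ik.
by have [] := integ_indep_sigma_rv ZZ mU mV iU iV.
Qed.

Lemma noise_rows_uncorrelated i k j : i != k -> \int[P]_w (z i j w * z k j w) = 0.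
Proof.
move=> ik; rewrite (noise_rows_indep ik) ?noise_mean ?mul0r//;
  try exact: noise_integ; exact: sigma_rv_measurable.
Qed.

Lemma noise_strong_law j :
  {ae P, forall w, (fun p => p%:R^-1 * \sum_(i < p) z i j w) @ \oo --> (0 : R)}.
Proof.
have [K _ HK] := noise_moments_bound.
apply: (@strong_law_orthogonal _ _ _ P (fun i => z i j) K) => //.
- by move=> i; exact: noise_integX.
- by move=> i; have [] := HK i j.
- by move=> i k; exact: noise_rows_uncorrelated.
Qed.

(** The centred products z_ij z_ik - D depend on different rows for different i, hence are
    independent with mean 0, and their squares are controlled by the fourth moments of the noise. *)
Lemma noise_gram_strong_law j k : {ae P, forall w,
  (fun p => p%:R^-1 * \sum_(i < p) z i j w * z i k w) @ \oo -->
  delta ^+ 2 * (j == k)%:R}.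
Proof.
have [K K1 HK] := noise_moments_bound.
set D := delta ^+ 2 * _; pose Y i w := z i j w * z i k w - D.
have Y2 i w : Y i w ^+ 2 <= z i j w ^+ 4 + z i k w ^+ 4 + 2 * D ^+ 2.
  rewrite /Y; set a := z i j w; set b := z i k w.
  have := sqr_ge0 (a ^+ 2 - b ^+ 2); have := sqr_ge0 (a * b + D); lra.
have iB i : integ P (fun w => z i j w ^+ 4 + z i k w ^+ 4 + 2 * D ^+ 2).
  by apply: integD; [apply: integD; exact: noise_integ4|exact: integ_cst].
have mY i : measurable_fun setT (Y i).
  by apply: measurable_funD; [exact: measurable_funM|exact: measurable_cst].
have iY2 i : integ P (fun w => Y i w ^+ 2).
  apply: integ_dominated (iB i); first exact: measurable_funX.
  by move=> w; rewrite ger0_norm ?sqr_ge0.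
have iY i : integ P (Y i) by apply: integD; [exact: noise_integM|exact: integ_cst].
have EY i : \int[P]_w Y i w = 0.
  rewrite /Y RintegralB//; [|exact: noise_integM|exact: integ_cst].
  rewrite noise_cov Rintegral_cst// (congr1 fine (probability_setT P)) mulr1.
  by rewrite subrr.
have gY i : measurable_fun setT (Y i : g_sigma_algebraType (rv_preimages (Z i)) -> R).
  apply: measurable_funD; last exact: measurable_cst.
  by apply: measurable_funM; exact: sigma_rv_measurable.
have : {ae P, forall w, (fun p => p%:R^-1 * \sum_(i < p) Y i w) @ \oo --> (0 : R)}.
  apply: (@strong_law_orthogonal _ _ _ P Y (2 * K + 2 * D ^+ 2)) => //.
    move=> i; apply: (@le_trans _ _
      (\int[P]_w (z i j w ^+ 4 + z i k w ^+ 4 + 2 * D ^+ 2))).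
      by apply: (le_Rintegral measurableT (iY2 i) (iB i)) => w _; exact: Y2.
    rewrite RintegralD//; last 2 first.
    - by apply: integD; exact: noise_integ4.
    - exact: integ_cst.
    rewrite RintegralD//; [|exact: noise_integ4|exact: noise_integ4].
    rewrite Rintegral_cst// (congr1 fine (probability_setT P)) mulr1.
    by have [_ ?] := HK i j; have [_ ?] := HK i k; lra.
  by move=> i l il; rewrite (noise_rows_indep il)// !EY mul0r.
apply: filterS => w H.
have H' : (fun p => p%:R^-1 * \sum_(i < p) Y i w + D) @ \oo --> D.
  by rewrite -[X in _ --> X]add0r; apply: cvgD => //; exact: cvg_cst.
apply: cvg_pos_eq H' => p p0.
rewrite sumrB sumr_const card_ord mulrBr -[D *+ p]mulr_natl.
by rewrite mulKf ?subrK// pnatr_eq0 -lt0n.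
Qed.

End noise.

(** * Joint behaviour of beta, the random partition and the noise *)

Section beta_noise.
Context (R : realType) d (T : measurableType d) (P : probability T R) (n : nat)
  (beta : nat -> {RV P >-> R}) (X : 'I_n -> {RV P >-> R})
  (Z : nat -> 'I_n -> {RV P >-> R}) (delta : R).
Hypothesis hA2 : A2 beta X Z.
Hypothesis hA4 : A4 Z delta.

Let Zall (ij : nat * 'I_n) : T -> R := Z ij.1 ij.2.

Lemma indep_beta_noise : indep_sets P (sigma_rv beta) (sigma_rv Zall).
Proof.
pose F (k : 'I_3) := tnth [tuple sigma_rv beta; sigma_rv X;
  sigma_rv (fun ij : nat * 'I_n => Z ij.1 ij.2)] k.
have sF k : sigma_algebra setT (F k).
  by case: k => [[|[|[|]]]]// ?; exact: sigma_rv_algebra.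
exact: (@mutual_indep_pair _ _ _ P _ F ord0 (@Ordinal 3 2 isT) sF hA2 isT).
Qed.

(** Independence of beta and Z factors the mean of b_i Z_ij b_k Z_kj into that of b_i b_k times that
    of Z_ij Z_kj, which is 0 for i and k distinct: the orthogonal strong law applies. *)
Lemma beta_noise_strong_law (C : R) j :
  {ae P, forall w, (forall i, `|beta i w| <= C) ->
    (fun p => p%:R^-1 * \sum_(i < p) beta i w * Z i j w) @ \oo --> (0 : R)}.
Proof.
(* [beta] is bounded only almost surely; clamping it keeps it measurable for
   the sigma-algebra of [beta] *)
pose b i w : R := Num.max (- C) (Num.min C (beta i w)).
have gb i : measurable_fun setT (b i : g_sigma_algebraType (rv_preimages beta) -> R).
  apply: measurable_maxr; first exact: measurable_cst.
  by apply: measurable_minr; [exact: measurable_cst|exact: sigma_rv_measurable].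
have mb i : measurable_fun setT (b i).
  apply: measurable_maxr; first exact: measurable_cst.
  by apply: measurable_minr; [exact: measurable_cst|exact: measurable_funP].
have gz i : measurable_fun setT
    ((Z i j : T -> R) : g_sigma_algebraType (rv_preimages Zall) -> R).
  exact: (@sigma_rv_measurable _ _ _ _ Zall (i, j)).
have bC i w : `|b i w| <= `|C|.
  rewrite /b ler_norml; apply/andP; split.
    by rewrite le_max lerN2 ler_norm.
  rewrite ge_max ge_min ler_norm /= andbT.
  by rewrite -normrN ler_norm.
have bbC i k w : `|b i w * b k w| <= C ^+ 2.
  by rewrite normrM -(real_normK (num_real C)) expr2 ler_pM.
have ibb i k : integ P (fun w => b i w * b k w).
  apply: integ_dominated (bbC i k) (integ_cst P _).
  exact: measurable_funM.
have izz i k : integ P (fun w => Z i j w * Z k j w).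
  by apply: integ_mul; [exact: measurable_funP|exact: measurable_funP|
    exact: (noise_integX hA4)|exact: (noise_integX hA4)].
have M i k := integ_indep_sigma_rv indep_beta_noise
  (measurable_funM (gb i) (gb k)) (measurable_funM (gz i) (gz k)) (ibb i k) (izz i k).
have ME i k : (fun w => b i w * Z i j w * (b k w * Z k j w)) =
    (fun w => b i w * b k w * (Z i j w * Z k j w)).
  by apply/funext => w; ring.
have mbz i : measurable_fun setT (fun w => b i w * Z i j w).
  by apply: measurable_funM => //; exact: measurable_funP.
have H : {ae P, forall w,
    (fun p => p%:R^-1 * \sum_(i < p) b i w * Z i j w) @ \oo --> (0 : R)}.
  apply: (@strong_law_orthogonal _ _ _ P (fun i w => b i w * Z i j w)
    (C ^+ 2 * delta ^+ 2)) => //.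
  - by move=> i; rewrite [X in integ _ X](ME i i); have [] := M i i.
  - move=> i; rewrite [X in Rintegral _ _ X](ME i i); have [_ ->] := M i i.
    have := noise_cov hA4 i j j; rewrite eqxx mulr1 => ->.
    rewrite ler_wpM2r ?sqr_ge0//.
    apply: (@le_trans _ _ (\int[P]_w (C ^+ 2))).
      apply: (le_Rintegral measurableT (ibb i i) (integ_cst P _)) => w _.
      exact: le_trans (ler_norm _) (bbC i i w).
    by rewrite Rintegral_cst// (congr1 fine (probability_setT P)) mulr1.
  - move=> i k ik; rewrite [X in Rintegral _ _ X](ME i k); have [_ ->] := M i k.
    by rewrite (noise_rows_uncorrelated hA4 j ik) mulr0.
apply: filterS H => w H bw; apply: cvg_trans H; apply: near_eq_cvg; near=> p.
congr (_ * _); apply: eq_bigr => i _; congr (_ * _).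
have := bw i; rewrite ler_norml => /andP[b1 b2].
by rewrite /b (min_idPr b2) (max_idPr b1).
Unshelve. all: by end_near. Qed.

Lemma noise_block_cvg0 (Q : forall p, T -> {set {set 'I_p}}) j :
  (forall p (A : {set {set 'I_p}}), sigma_rv beta [set w | Q p w = A]) ->
  {ae P, forall w,
    (exists N : R, forall p, \sum_(q < p) (#|Q q w|%:R / q%:R) ^+ 2 <= N) ->
    (fun p => p%:R^-1 * blockdot (Q p w) (\col_i Z i j w) (\col_i Z i j w))
      @ \oo --> (0 : R)}.
Proof.
move=> gQ; have [K K1 HK] := noise_moments_bound hA4.
have [_ _ _ iZ _] := hA4.
apply: (@ae_block_cvg0 _ _ _ P (fun i => sigma_rv (Z i)) (fun i => Z i j) K _ _
  iZ _ _ _ _ _ K1 (rv_preimages beta)) => //.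
- by move=> i; exact: sigma_rv_algebra.
- by move=> i; apply: sub_sigma_rv => k; exact: measurable_funP.
- move=> i A mA; apply: (@sigma_rv_preimage _ _ _ _ (Z i) (Z i j)) => //.
  exact: sigma_rv_measurable.
- by move=> i; exact: (noise_integ4 hA4).
- by move=> i; exact: (noise_mean hA4).
- by move=> i; have [] := HK i j.
- by move=> i; have [] := HK i j.
- by apply: sub_sigma_rv => i; exact: measurable_funP.
(* The sigma-algebra generated by all the rows is contained in that of the whole array, which is
   independent of beta. *)
- move=> A B bA FB; apply: indep_beta_noise => //.
  apply: smallest_sub FB; first exact: sigma_rv_algebra.
  move=> D [i _]; apply: smallest_sub D; first exact: sigma_rv_algebra.
  move=> _ [k _ [D mD <-]]; apply: sub_sigma_algebra.
  by exists (i, k) => //; exists D.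
Qed.

End beta_noise.

(** Partial sums of a convergent series of nonnegative terms stay below its limit. The term at q = 0
    is 0, as 0 has inverse 0. *)
Lemma sqrt_dominated_bounded (R : realType) (k : nat -> nat) : sqrt_dominated R k ->
  exists N : R, forall p, \sum_(q < p) ((k q)%:R / q%:R) ^+ 2 <= N.
Proof.
move=> [_ _ cvgk]; exists (limn (series (fun p => (k p)%:R ^+ 2 / p%:R ^+ 2 : R))) => p.
apply: le_trans (nondecreasing_cvgn_le _ cvgk p).
  rewrite /series/= big_mkord; apply: ler_sum => q _.
  by rewrite exprMn exprVn.
by apply: nondecreasing_series => q _ _; rewrite divr_ge0 ?sqr_ge0.
Qed.

(** The partition may depend on the outcome, but only through beta, and h is any choice of leading
    eigenvectors. The conclusion concerns outcomes with a nonzero factor: when X vanishes the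
    returns are pure noise. *)
Theorem theorem2p3 (R : realType) (d : measure_display)
  (T : measurableType d) (P : probability T R)
  (n : nat) (hn : (2 <= n)%N)
  (beta : nat -> {RV P >-> R}) (X : 'I_n -> {RV P >-> R})
  (Z : nat -> 'I_n -> {RV P >-> R}) (sigma delta : R)
  (hA1 : A1 beta) (hA2 : A2 beta X Z) (hA3 : A3 X sigma) (hA4 : A4 Z delta)
  (h : forall p : nat, T -> 'cV[R]_p)
  (hh : forall (p : nat) (w : T), (0 < p)%N ->
    leading_eigvec (returns (beta ^~ w) (X ^~ w) (fun i j => Z i j w) p)
                   (h p w))
  (Q : forall p : nat, T -> {set {set 'I_p}})
  (Qbeta : forall (p : nat) (A : {set {set 'I_p}}),
    sigma_rv beta [set w | Q p w = A])
  (Qpart : forall (p : nat) (w : T), finset.partition (Q p w) [set: 'I_p]%SET)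
  (Qord : {ae P, forall w, forall p : nat,
    ordered_partition (beta ^~ w) (Q p w)})
  (Qunif : {ae P, forall w, semi_uniform R (fun p => Q p w)})
  (Qinfty : {ae P, forall w, (fun p => #|Q p w|) @ \oo --> \oo})
  (Qdom : {ae P, forall w, sqrt_dominated R (fun p => #|Q p w|)}) :
  {ae P, forall w, (exists j, X j w <> 0) ->
    (fun p : nat =>
       enorm (maps (returns (beta ^~ w) (X ^~ w) (fun i j => Z i j w) p)
                   (h p w) (partition_space R (Q p w))
              - normalize (beta_vec (beta ^~ w) p))) @ \oo --> (0 : R)}.
Proof.
have [[C bC] _ blim] := hA1; have [d0 _ _ _ _] := hA4.
have aeC : {ae P, forall w, forall i, `|beta i w| <= C} by exact: ae_foralln.
have ae_ord (I : 'I_n -> T -> Prop) : (forall j, {ae P, forall w, I j w}) ->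
    {ae P, forall w, forall j, I j w}.
  by move=> HI; exact: (filter_forall (ae_filter_ringOfSetsType P) HI).
have L1 := ae_ord _ (beta_noise_strong_law hA2 hA4 C).
have L2 := ae_ord _ (noise_strong_law hA4).
have L3 := ae_ord _ (fun j => ae_ord _ (noise_gram_strong_law hA4 j)).
have L4 := ae_ord _ (fun j => noise_block_cvg0 hA2 hA4 j Qbeta).
(* The almost sure properties are finite or countable in number; an outcome satisfying all of them
   at once meets the hypotheses of [cvg_maps]. *)
near=> w => Xw.
have Cw : forall i, `|beta i w| <= C by near: w.
have [[m m0 mcvg] [r r0 rcvg]] :
    (exists2 m : R, 0 < m & beta_mean (beta ^~ w) @ \oo --> m) /\
    (exists2 r : R, 0 < r & beta_disp (beta ^~ w) @ \oo --> r) by near: w.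
have Qord_w : forall p, ordered_partition (beta ^~ w) (Q p w) by near: w.
have Qunif_w : semi_uniform R (fun p => Q p w) by near: w.
have Qinfty_w : (fun p => #|Q p w|) @ \oo --> \oo by near: w.
have Qdom_w : sqrt_dominated R (fun p => #|Q p w|) by near: w.
have L1w : forall j, (forall i, `|beta i w| <= C) ->
    (fun p => p%:R^-1 * \sum_(i < p) beta i w * Z i j w) @ \oo --> (0 : R) by near: w.
have L2w : forall j, (fun p => p%:R^-1 * \sum_(i < p) Z i j w) @ \oo --> (0 : R).
  by near: w.
have L3w : forall j k, (fun p => p%:R^-1 * \sum_(i < p) Z i j w * Z i k w) @ \oo -->
    delta ^+ 2 * (j == k)%:R by near: w.
have L4w : forall j,
    (exists N : R, forall p, \sum_(q < p) (#|Q q w|%:R / q%:R) ^+ 2 <= N) ->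
    (fun p => p%:R^-1 * blockdot (Q p w) (\col_i Z i j w) (\col_i Z i j w))
      @ \oo --> (0 : R).
  by near: w.
apply: (@cvg_maps R n (beta ^~ w) (X ^~ w) (fun i j => Z i j w) (h ^~ w) (Q ^~ w)
  C m r (delta ^+ 2)) => //.
- by rewrite exprn_gt0.
- by move=> p p0; exact: hh.
- by move=> j; exact: L1w.
- by move=> j; apply: L4w; exact: (sqrt_dominated_bounded Qdom_w).
Unshelve. all: by end_near. Qed.
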